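(* Let $p\ge5$ be a prime. For all $n\in\mathbb{N}$ and all $\theta\in\operatorname{Irr}(P_n)$, where $P_n$ is a Sylow $p$-subgroup of $S_n$, we have $M(\theta)=n-\gamma_0(\theta)$.
   Context: **Partitions and characters.** $\mathbb{N}=\{1,2,\dots\}$, $\mathbb{N}_0=\mathbb{N}\cup\{0\}$, $[x,y]=\{z\in\mathbb{Z}: x\le z\le y\}$. $\mathcal{P}(n)$ is the set of partitions of $n$; $\lambda_1$ is the largest part of $\lambda$, $\ell(\lambda)$ its number of parts. $\chi^\lambda\in\operatorname{Irr}(S_n)$ is the usual irreducible complex character labelled by $\lambda$. $\downarrow,\uparrow$ denote restriction and induction, $[\cdot,\cdot]$ the inner product of characters. For $\theta\in\operatorname{Irr}(P_n)$, $\Omega(\theta)=\{\lambda\in\mathcal{P}(n): [\chi^\lambda\downarrow_{P_n},\theta]\neq 0\}$. $\mathcal{B}_n(t)=\{\lambda\in\mathcal{P}(n): \lambda_1\le t,\ \ell(\lambda)\le t\}$. $M(\theta)=\min\{t\in\mathbb{N}: \Omega(\theta)\subseteq\mathcal{B}_n(t)\}$. **Characters of $P_{p^k}$.** For a finite group $K$, $K\wr C_p=K^{\times p}\rtimes C_p$ with $C_p$ permuting the factors cyclically. If $\phi$ is a character of $K$ afforded by a module $W$ and $\psi$ a character of $C_p$, then $\mathcal{X}(\phi;\psi)=\widetilde{\phi^{\times p}}\cdot\psi$, where $\widetilde{\phi^{\times p}}$ is the character of $K\wr C_p$ on $W^{\otimes p}$ ($K^{\times p}$ acting factorwise, $C_p$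 permuting tensor factors) and $\psi$ is inflated to $K\wr C_p$. Here $P_1$ is trivial, $P_p\cong C_p$, and $P_{p^k}=P_{p^{k-1}}\wr P_p$. Let $\phi_0,\dots,\phi_{p-1}$ be the irreducible characters of $P_p$, $\phi_0$ trivial. Objects are called mixed if they are not all equal. For $k\ge 2$, each $\theta\in\operatorname{Irr}(P_{p^k})$ has exactly one of the forms: (i) $\theta=(\theta_1\times\cdots\times\theta_p)\uparrow^{P_{p^k}}$ with $\theta_1,\dots,\theta_p\in\operatorname{Irr}(P_{p^{k-1}})$ mixed; (ii) $\theta=\mathcal{X}(\phi;\phi_\varepsilon)$ with $\phi\in\operatorname{Irr}(P_{p^{k-1}})$, $\varepsilon\in[0,p-1]$. **Trees.** For $k\in\mathbb{N}$, $\mathcal{F}_k$ is the set of rooted complete $p$-ary trees of height $k-1$ (every vertex at distance less than $k-1$ from the root has $p$ ordered children; those at distance $k-1$ are leaves) with every vertex labelled by an element of $\{0,1,\dots,p\}$. $(T_1\mid\dots\mid T_p;\varepsilon)$ is the tree with root label $\varepsilon$ and subtrees $T_1,\dots,T_p$ at the children of the root. Two trees in $\mathcal{F}_k$ are equivalent if one is obtained from the other by cyclically permuting the $p$ subtrees below non-leaf vertices (any number of times). To $\theta\in\operatorname{Irr}(P_{p^k})$ one associates an equivalence class $\mathcal{T}(\theta)$: for $k=1$, $\mathcal{T}(\phi_\varepsilon)$ is the single vertex labelled $\varepsilon$; for $k\ge2$, in case (ii) it is the class of $(T_1\mid\dots\mid T_p;\varepsilon)$ with all $T_i\in\mathcal{T}(\phi)$,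 and in case (i) the class of $(T_1\mid\dots\mid T_p;p)$ with $T_i\in\mathcal{T}(\theta_i)$. This is well defined. **Statistics.** For $T\in\mathcal{F}_k$, a vertex is a person if its label lies in $[1,p-1]$. For people $x,y$ in $T$ and $t\in\mathbb{N}_0$, $y$ is a $t$-descendant of $x$ if there is a descending path $x=x_0,x_1,\dots,x_m=y$ (each step going from a vertex to one of its children) such that exactly $t$ of $x_1,\dots,x_m$ are people. $\gamma_0(T)$ is the number of people in $T$ having no $1$-descendant (every person being its own $0$-descendant). For $\theta\in\operatorname{Irr}(P_{p^k})$, $\gamma_0(\theta)=\gamma_0(T)$ for any $T\in\mathcal{T}(\theta)$. For general $n$, write $n=\sum_{i=1}^t p^{n_i}$ with $0\le n_1\le\dots\le n_t$ and each value occurring at most $p-1$ times ($p$-adic expansion). Then $P_n=P_{p^{n_1}}\times\dots\times P_{p^{n_t}}$ and $\theta=\theta_1\times\dots\times\theta_t$ with $\theta_i\in\operatorname{Irr}(P_{p^{n_i}})$; set $\gamma_0(\theta)=\sum_i\gamma_0(\theta_i)$, where $\gamma_0(\theta_i)=0$ if $n_i=0$ (trivial group $P_1$). *)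

(* Defs.v *)
From HB Require Import structures.
From mathcomp Require Import all_boot all_order all_fingroup all_algebra.
From mathcomp Require Import all_solvable all_field all_character.

Set Implicit Arguments.
Unset Strict Implicit.
Unset Printing Implicit Defensive.

Import GroupScope GRing.Theory.
Local Open Scope ring_scope.

(* Composition of a class function with a group morphism: restriction along an
   embedding, or inflation along a surjection. *)
Definition cfPull (aT rT : finGroupType) (D : {group aT})
    (f : {morphism D >-> rT}) (psi : 'CF([set: rT])) : 'CF(D) :=
  cfMorph ('Res[f @* D] psi).

Section Partitions.

Variable n : nat.

Definition is_partition (la : n.-bseq 'I_n.+1) : bool :=
  [&& sorted geq (map val la), all (fun m : 'I_n.+1 => 0 < m)%N la
    & sumn (map val la) == n].

Definition partition_of : finType := {la : n.-bseq 'I_n.+1 | is_partition la}.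

Definition parts (la : partition_of) : seq nat := map val (val la).

(* The partitions whose Young diagram fits in a t x t square. *)
Definition Bset (t : nat) : {set partition_of} :=
  [set la | (head 0%N (parts la) <= t)%N && (size (parts la) <= t)%N].

End Partitions.

(* For a partition la of #|T|, the elements of T fill the Young diagram of la
   row by row in the order of enum T; [reshape_index] and [reshape_offset] are
   then the row and the column of an entry.  The Specht module is realised as
   the right ideal generated by the Young symmetrizer in the group algebra. *)
Section Specht.

Variables (T : finType) (la : seq nat).

Definition tab_row (x : T) : nat := reshape_index la (enum_rank x).
Definition tab_col (x : T) : nat := reshape_offset la (enum_rank x).

Definition row_stab : {set {perm T}} :=
  [set s : {perm T} | [forall x, tab_row (s x) == tab_row x]].
Definition col_stab : {set {perm T}} :=
  [set s : {perm T} | [forall x, tab_col (s x) == tab_col x]].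

Let aG := regular_repr algC [set: {perm T}].

Definition young_symmetrizer : 'rV[algC]_(gcard [set: {perm T}]) :=
  gring_row ((\sum_(s in row_stab) aG s)
             *m (\sum_(s in col_stab) (-1) ^+ s *: aG s)).

Definition specht_char : 'CF([set: {perm T}]) :=
  cfRepr (submod_repr (cyclic_mx_module aG young_symmetrizer)).

End Specht.

Section Wreath.

Variables (p : nat) (gT : finGroupType).

(* For p > 1, 'Z_p has p elements; it serves both as C_p (additively) and as the
   set of positions of the factors of K^p, on which c acts by i |-> i + c. *)
Definition wreath : Type := ({ffun 'Z_p -> gT} * 'Z_p)%type.

HB.instance Definition _ := Finite.on wreath.

Definition wreath_mul (u v : wreath) : wreath :=
  ([ffun i => (u.1 i * v.1 (i + u.2))%g], u.2 + v.2).
Definition wreath_one : wreath := ([ffun=> 1%g], 0).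
Definition wreath_inv (u : wreath) : wreath :=
  ([ffun i => (u.1 (i - u.2))^-1%g], - u.2).

Fact wreath_mulA : associative wreath_mul.
Proof.
move=> u v w; rewrite /wreath_mul /=; congr pair; last by rewrite addrA.
by apply/ffunP=> i; rewrite !ffunE mulgA addrA.
Qed.
Fact wreath_mul1 : left_id wreath_one wreath_mul.
Proof.
case=> f c; rewrite /wreath_mul /= add0r; congr pair.
by apply/ffunP=> i; rewrite !ffunE mul1g addr0.
Qed.
Fact wreath_mulV : left_inverse wreath_one wreath_inv wreath_mul.
Proof.
case=> f c; rewrite /wreath_mul /= addNr; congr pair.
by apply/ffunP=> i; rewrite !ffunE mulVg.
Qed.
HB.instance Definition _ :=
  Finite_isGroup.Build wreath wreath_mulA wreath_mul1 wreath_mulV.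

Lemma wreath_topM :
  {in [set: wreath] &, {morph (fun u : wreath => u.2) : u v / (u * v)%g}}.
Proof. by []. Qed.
Definition wreath_top := Morphism wreath_topM.

(* The subgroup K^p of K wr C_p. *)
Definition wreath_base : {group wreath} := ('ker wreath_top)%G.

Section Coord.
Variable i : 'Z_p.
Lemma wreath_coordM :
  {in wreath_base &, {morph (fun u : wreath => u.1 i) : u v / (u * v)%g}}.
Proof.
move=> u v /kerP/= Ku _; have /Ku u2 : u \in [set: wreath] by rewrite inE.
by rewrite /= ffunE u2 addr0.
Qed.
Definition wreath_coord := Morphism wreath_coordM.
End Coord.

(* The character th_1 x ... x th_p of K^p. *)
Definition cf_base (th : 'Z_p -> 'CF([set: gT])) : 'CF(wreath_base) :=
  \prod_i cfPull (wreath_coord i) (th i).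

(* If rK is a representation of K on W = 'rV_d, then W^{(x) p} has the basis
   e_a = e_(a 0) (x) ... (x) e_(a p.-1), for a : {ffun 'Z_p -> 'I_d}.  The action
   of (f, c) applies f i to the i-th tensor factor, and then moves it to
   position i + c. *)
Section TensorInduction.

Variables (d : nat) (rK : mx_representation algC [set: gT] d).

Definition tensor_index (a : 'I_#|{ffun 'Z_p -> 'I_d}|) : {ffun 'Z_p -> 'I_d} := enum_val a.

Definition tensor_mx (u : wreath) : 'M[algC]_#|{ffun 'Z_p -> 'I_d}| :=
  \matrix_(a, b) \prod_i rK (u.1 i) (tensor_index a i) (tensor_index b (i + u.2)).

Fact tensor_mx_repr : mx_repr [set: wreath] tensor_mx.
Proof.
split=> [|u v _ _]; apply/matrixP=> a b; rewrite !mxE.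
  have -> : (a == b) = (tensor_index a == tensor_index b).
    by rewrite (inj_eq enum_val_inj).
  have [->|neq_ab] := eqVneq.
    by rewrite big1 // => i _; rewrite ffunE repr_mx1 addr0 mxE eqxx.
  have [i neq_i] : exists i, tensor_index a i != tensor_index b i.
    apply/existsP; rewrite -negb_forall; apply: contra neq_ab => /forallP eq_ab.
    by apply/eqP/ffunP=> i; apply/eqP.
  by rewrite (bigD1 i) //= ffunE repr_mx1 addr0 mxE (negPf neq_i) mul0r.
transitivity (\sum_(f : {ffun 'Z_p -> 'I_d}) \prod_i
   (rK (u.1 i) (tensor_index a i) (f i)
    * rK (v.1 (i + u.2)) (f i) (tensor_index b (i + u.2 + v.2)))).
  rewrite -(bigA_distr_bigA (fun i j => rK (u.1 i) (tensor_index a i) j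
    * rK (v.1 (i + u.2)) j (tensor_index b (i + u.2 + v.2)))) /=.
  apply: eq_bigr => i _; rewrite ffunE repr_mxM ?inE // mxE addrA.
  by apply: eq_bigr.
have sh_bij : bijective (fun f : {ffun 'Z_p -> 'I_d} => [ffun i => f (i + u.2)]).
  exists (fun f : {ffun 'Z_p -> 'I_d} => [ffun i => f (i - u.2)]) => f;
  by apply/ffunP=> i; rewrite !ffunE ?addrNK ?addrK.
rewrite (reindex _ (onW_bij _ sh_bij)) (reindex _ (onW_bij _ (enum_val_bij _))).
apply: eq_bigr => c _; rewrite !mxE big_split /=; congr (_ * _).
  by apply: eq_bigr => i _; rewrite ffunE.
rewrite [RHS](reindex (fun i => i + u.2)) /=; last first.
  by exists (fun i => i - u.2) => i _; rewrite ?addrK ?addrNK.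
by apply: eq_bigr => i _; rewrite ffunE.
Qed.
Canonical tensor_repr := MxRepresentation tensor_mx_repr.

End TensorInduction.

(* X(phi; psi) for phi = 'chi_j, afforded by the module 'Chi_j. *)
Definition cfX (j : Iirr [set: gT]) (psi : 'CF([set: 'Z_p])) :
    'CF([set: wreath]) :=
  cfRepr (tensor_repr 'Chi_j) * cfPull wreath_top psi.

End Wreath.

Section WreathAction.

Variables (p : nat) (gT : finGroupType) (X : finType).
Variable to : {action gT &-> X}.

Definition wreath_act (x : 'Z_p * X) (u : wreath p gT) : 'Z_p * X :=
  (x.1 + u.2, to x.2 (u.1 x.1)).

Fact wreath_act1 : wreath_act^~ 1%g =1 id.
Proof. by case=> i x; rewrite /wreath_act /= addr0 ffunE act1. Qed.
Fact wreath_actM x : act_morph wreath_act x.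
Proof.
move=> u v; rewrite /wreath_act /= ffunE actM; congr pair; exact: addrA.
Qed.
Definition wreath_action := TotalAction wreath_act1 wreath_actM.

End WreathAction.

Section Tower.

Variable p : nat.

(* Ptow k is P_{p^(k+1)}, acting on the p^(k+1) elements of Xtow k. *)
Fixpoint Ptow (k : nat) : finGroupType :=
  if k is k'.+1 then wreath p (Ptow k') else 'Z_p.

Fixpoint Xtow (k : nat) : finType :=
  if k is k'.+1 then ('Z_p * Xtow k')%type else 'Z_p.

Fixpoint acttow (k : nat) : {action Ptow k &-> Xtow k} :=
  if k is k'.+1 then wreath_action p (acttow k') else 'R%act.

(* Ppow k is P_{p^k}, acting on the p^k elements of Xpow k. *)
Definition Ppow (k : nat) : finGroupType := if k is k'.+1 then Ptow k' else 'I_1.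

Definition Xpow (k : nat) : finType := if k is k'.+1 then Xtow k' else 'I_1.

Definition actpow (k : nat) : {action Ppow k &-> Xpow k} :=
  if k is k'.+1 then acttow k' else 'R%act.

(* The exponents n_1 <= ... <= n_t of the p-adic expansion of n; see
   [sorted_expo], [count_expo] and [sum_expo]. *)
Definition expo (n : nat) : seq nat :=
  flatten [seq nseq ((n %/ p ^ k) %% p) k | k <- iota 0 n.+1].

Definition expo_nth (n : nat) (i : 'I_(size (expo n))) : nat :=
  nth 0%N (expo n) i.

Definition Pprod (n : nat) : finGroupType :=
  {dffun forall i : 'I_(size (expo n)), Ppow (expo_nth i)}.

(* The set permuted by S_n, of size n by [card_points]: the disjoint union of the supports of
   the factors of P_n. *)
Definition points (n : nat) : finType :=
  {i : 'I_(size (expo n)) & Xpow (expo_nth i)}.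

Definition prod_act (n : nat) (x : points n) (u : Pprod n) : points n :=
  Tagged (fun i => Xpow (expo_nth i)) (actpow _ (tagged x) (u (tag x))).

Fact prod_act1 n : (@prod_act n)^~ 1%g =1 id.
Proof. by case=> i x; rewrite /prod_act /= oneg_ffun act1. Qed.
Fact prod_actM n x : act_morph (@prod_act n) x.
Proof. by move=> u v; rewrite /prod_act /= mulg_ffun actM. Qed.
Definition prod_action n := TotalAction (@prod_act1 n) (@prod_actM n).

Definition Pembed (n : nat) : {morphism [set: Pprod n] >-> {perm (points n)}} :=
  actperm_morphism (prod_action n).

(* P_n as a subgroup of S_n; it is a Sylow p-subgroup by [Psyl_pSylow]. *)
Definition Psyl (n : nat) : {group {perm (points n)}} :=
  (Pembed n @* [set: Pprod n])%G.

End Tower.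

Section Trees.

Variable p : nat.

(* tree k is F_(k+1), the complete p-ary trees of height k; the children of a
   vertex are indexed by 'Z_p. *)
Fixpoint tree (k : nat) : finType :=
  if k is k'.+1 then ('I_p.+1 * {ffun 'Z_p -> tree k'})%type else 'I_p.+1.

(* One cyclic permutation of the subtrees below one non-leaf vertex. *)
Fixpoint rot_step (k : nat) : rel (tree k) :=
  if k is k'.+1 then fun T U : tree k'.+1 =>
    (T.1 == U.1) &&
    ([exists c : 'Z_p, forall i, U.2 i == T.2 (i + c)]
     || [exists i, rot_step (T.2 i) (U.2 i)
                   && [forall j, (j != i) ==> (U.2 j == T.2 j)]])
  else fun _ _ => false.

Definition tree_equiv (k : nat) : rel (tree k) := connect (@rot_step k).

(* The equivalence class of trees attached to th. The characters phi_eps of C_p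
   are enumerated by [irr]; in particular 'chi_0 is the trivial character. *)
Fixpoint Tclass (k : nat) : 'CF([set: Ptow p k]) -> {set tree k} :=
  if k is k'.+1 then fun th => [set U : tree k'.+1 | [exists T : tree k'.+1,
    [&& tree_equiv T U &
      [exists phi : Iirr [set: Ptow p k'], exists eps : Iirr [set: 'Z_p],
         [&& th == cfX phi 'chi_eps, T.1 == eps :> nat
           & [forall i, T.2 i \in Tclass 'chi_phi]]]
      || [exists phi : {ffun 'Z_p -> Iirr [set: Ptow p k']},
         [&& ~~ [forall i, forall j, phi i == phi j],
             th == 'Ind[[set: Ptow p k'.+1]] (cf_base (fun i => 'chi_(phi i))),
             T.1 == p :> nat
           & [forall i, T.2 i \in Tclass 'chi_(phi i)]]]]]]
  else fun th => [set U : tree 0 |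
    [exists eps : Iirr [set: 'Z_p], (th == 'chi_eps) && (U == eps :> nat)]].

(* A vertex of a tree of height k is the sequence, of size at most k, of the
   positions of the children on the path from the root. *)
Definition vertex (k : nat) : finType := {bseq k of 'Z_p}.

Fixpoint label (k : nat) : tree k -> seq 'Z_p -> nat :=
  if k is k'.+1 then fun T v => if v is i :: v' then label (T.2 i) v' else T.1
  else fun T _ => T.

Definition person (k : nat) (T : tree k) (v : seq 'Z_p) : bool :=
  (0 < label T v < p)%N.

(* The vertices x_1, ..., x_m of the descending path from x to y are the
   prefixes of y longer than x. *)
Definition descendant (k : nat) (T : tree k) (t : nat) (x y : seq 'Z_p) : bool :=
  [&& person T x, person T y, prefix x y
    & count (person T)
        [seq take l y | l <- iota (size x).+1 (size y - size x)] == t].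

Definition gamma0_tree (k : nat) (T : tree k) : nat :=
  #|[set x : vertex k | person T x
      && ~~ [exists y : vertex k, descendant T 1 x y]]|.

Definition gamma0_tow (k : nat) (th : 'CF([set: Ptow p k])) : nat :=
  if [pick T in Tclass th] is Some T then gamma0_tree T else 0.

Definition gamma0_pow (k : nat) : 'CF([set: Ppow p k]) -> nat :=
  if k is k'.+1 then @gamma0_tow k' else fun _ => 0%N.

(* The character th_1 x ... x th_t of P_{p^n_1} x ... x P_{p^n_t}. *)
Definition cf_prod (n : nat)
    (th : forall i : 'I_(size (expo p n)), 'CF([set: Ppow p (expo_nth i)])) :
    'CF([set: Pprod p n]) :=
  \prod_i cfPull (dffun_morphism (fun i => Ppow p (expo_nth i)) i) (th i).

Definition gamma0_prod (n : nat) (th : 'CF([set: Pprod p n])) : nat :=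
  if [pick phi : {dffun forall i : 'I_(size (expo p n)),
                    Iirr [set: Ppow p (expo_nth i)]}
        | th == cf_prod (fun i => 'chi_(phi i))] is Some phi
  then \sum_i gamma0_pow 'chi_(phi i) else 0.

Definition gamma0 (n : nat) (th : 'CF(Psyl p n)) : nat :=
  gamma0_prod (cfMorph th).

End Trees.

Section BoundingSquare.

Variables (p n : nat) (th : 'CF(Psyl p n)).

Definition Omega : {set partition_of n} :=
  [set la | '['Res[Psyl p n] (specht_char (points p n) (parts la)), th] != 0].

Fact Omega_bounded : exists t, (0 < t)%N && (Omega \subset Bset n t).
Proof.
exists n.+1; rewrite ltnS leq0n; apply/subsetP=> la _; rewrite inE size_map.
rewrite (leqW (size_bseq _)) andbT /parts.
by case: (bseqval (val la)) => //= m s; apply: ltnW.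
Qed.

Definition Mbound : nat := ex_minn Omega_bounded.

End BoundingSquare.
Section Sylow.

Variable p : nat.
Hypothesis p_prime : prime p.
Let p_gt1 := prime_gt1 p_prime.

Lemma card_Zp_p : #|'Z_p| = p.
Proof. by rewrite card_ord Zp_cast. Qed.

Lemma card_Xpow k : #|Xpow p k| = (p ^ k)%N.
Proof.
case: k => [|k]; first by rewrite card_ord.
elim: k => [|k IHk]; first exact: card_Zp_p.
by rewrite card_prod card_Zp_p expnS -IHk.
Qed.

Lemma card_Ppow k : #|Ppow p k| = (p ^ \sum_(i < k) p ^ i)%N.
Proof.
case: k => [|k]; first by rewrite card_ord big_ord0.
elim: k => [|k IHk]; first by rewrite big_ord_recl big_ord0; exact: card_Zp_p.
rewrite big_ord_recl expnD [LHS]card_prod card_ffun card_Zp_p.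
rewrite [#|_|]IHk mulnC expn1; congr (_ * _)%N.
by rewrite -expnM mulnC big_distrr; congr expn; apply: eq_bigr => i _; rewrite lift0 expnS.
Qed.

Lemma wreath_act_faithful (gT : finGroupType) (X : finType)
    (to : {action gT &-> X}) (x0 : X) :
    (forall a, (forall x, to x a = x) -> a = 1%g) ->
  forall u, (forall x, wreath_action p to x u = x) -> u = 1%g.
Proof.
move=> to_inj [f c] fix_u; congr pair; last first.
  by have := congr1 fst (fix_u (0, x0)); rewrite /= add0r.
apply/ffunP=> i; rewrite ffunE; apply: to_inj => x.
by have := congr1 snd (fix_u (i, x)).
Qed.

Lemma actpow_faithful k u : (forall x, actpow p k x u = x) -> u = 1%g.
Proof.
case: k u => [|k] u; first by move=> _; rewrite [u]ord1 [RHS]ord1.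
have x0 : Xtow p k by elim: k {u} => [|k x]; [exact: 0 | exact: (0, x)].
elim: k x0 u => [|k IHk] x0 u fix_u.
  by have := fix_u 1%g; rewrite /= mul1g.
apply: (wreath_act_faithful x0.2 _ fix_u) => v; exact: (IHk x0.2).
Qed.

Lemma Pembed_inj n : 'injm (@Pembed p n).
Proof.
apply/subsetP=> u Ku; have u1 := mker Ku; apply/set1P/ffunP=> i.
rewrite oneg_ffun; apply: actpow_faithful => x.
have := congr1 (fun s : {perm _} => s (Tagged (fun i => Xpow p (expo_nth i)) x)) u1.
by rewrite actpermE perm1 => /eqP; rewrite eq_Tagged => /eqP.
Qed.

Lemma big_expo (F : nat -> nat) n :
  (\sum_(k <- expo p n) F k = \sum_(0 <= k < n.+1) (n %/ p ^ k) %% p * F k)%N.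
Proof.
rewrite /expo big_flatten big_map /index_iota subn0; apply: eq_bigr => k _.
by rewrite big_nseq iter_addn_0 mulnC.
Qed.

Lemma digitsS (F : nat -> nat) n m : (n < m)%N ->
  (\sum_(0 <= k < m.+1) (n %/ p ^ k) %% p * F k
   = n %% p * F 0 + \sum_(0 <= k < n.+1) (n %/ p %/ p ^ k) %% p * F k.+1)%N.
Proof.
move=> lt_nm; rewrite big_nat_recl // expn0 divn1; congr (_ + _)%N.
rewrite (big_cat_nat (n := n.+1)) //= [X in (_ + X)%N]big_nat_cond.
rewrite [X in (_ + X)%N]big1 ?addn0 => [|k /andP[/andP[lt_nk _] _]].
  by apply: eq_bigr => k _; rewrite expnS divnMA.
rewrite expnS divnMA [(_ %/ p ^ k)%N]divn_small ?mod0n //.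
rewrite (leq_ltn_trans (leq_div _ _)) // (ltn_trans lt_nk) //.
exact: ltn_expl.
Qed.

Lemma sum_digits n m : (n < m)%N ->
  (\sum_(0 <= k < m) (n %/ p ^ k) %% p * p ^ k = n)%N.
Proof.
elim: m n => // m IHm n lt_nm.
rewrite big_nat_recl // expn0 divn1 muln1 [RHS](divn_eq n p) addnC; congr addn.
have [-> | n_gt0] := posnP n.
  by rewrite div0n mul0n big1 // => i _; rewrite div0n mod0n.
rewrite -[in RHS](IHm (n %/ p)%N); last first.
  by rewrite (leq_trans (ltn_Pdiv p_gt1 n_gt0)) // -ltnS.
rewrite big_distrl; apply: eq_bigr => k _.
by rewrite expnS divnMA mulnA mulnAC.
Qed.

Lemma sum_digits_repunit n m : (n < m)%N ->
  (\sum_(0 <= k < m) (n %/ p ^ k) %% p * (\sum_(i < k) p ^ i) = logn p n`!)%N.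
Proof.
elim: m n => // m IHm n lt_nm.
rewrite big_nat_recl // big_ord0 muln0 add0n.
have [-> | n_gt0] := posnP n.
  by rewrite fact0 logn1 big1 // => i _; rewrite div0n mod0n.
have lt_dm : (n %/ p < m)%N.
  by rewrite (leq_trans (ltn_Pdiv p_gt1 n_gt0)) // -ltnS.
transitivity (n %/ p + logn p (n %/ p)`!)%N.
  rewrite -(IHm _ lt_dm) -[X in (X + _)%N](sum_digits lt_dm) -big_split.
  apply: eq_bigr => k _ /=; rewrite expnS divnMA -mulnDr; congr muln.
  by rewrite big_ord_recr addnC.
rewrite !logn_fact // [RHS]big_ltn // expn1 [in RHS]big_add1 /=; congr addn.
rewrite [RHS](big_cat_nat (ltn0Sn _) (ltn_Pdiv p_gt1 n_gt0)) /=.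
rewrite [X in _ = (_ + X)%N]big_nat_cond.
rewrite [X in _ = (_ + X)%N]big1 => [|k /andP[/andP[lt_k _] _]].
  by rewrite addn0; apply: eq_bigr => k _; rewrite expnS divnMA.
by rewrite expnS divnMA divn_small // (ltn_trans lt_k) // ltn_expl.
Qed.

Lemma sorted_expo n : sorted leq (expo p n).
Proof.
rewrite /expo (sorted_pairwise leq_trans).
elim: n.+1 0%N => //= l IHl m; rewrite pairwise_cat IHl andbT.
apply/andP; split.
  apply/allrelP=> i j /nseqP[-> _] /flatten_mapP[k].
  by rewrite mem_iota => /andP[lt_mk _] /nseqP[-> _]; apply: ltnW.
by elim: (_ %% _)%N => //= d ->; rewrite all_nseq leqnn orbT.
Qed.

Lemma count_expo n k : (count_mem k (expo p n) < p)%N.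
Proof.
rewrite -sum1_count big_mkcond big_expo.
rewrite (eq_bigr (fun i => if i == k then (n %/ p ^ k) %% p else 0)%N).
  rewrite -big_mkcond big_nat1_eq.
  by case: ifP => _; rewrite ?ltn_pmod ?(ltnW p_gt1).
by move=> i _ /=; case: eqP => [->|_]; rewrite ?muln1 ?muln0.
Qed.

Lemma sum_expo n : (\sum_(k <- expo p n) p ^ k = n)%N.
Proof. by rewrite big_expo sum_digits. Qed.

Lemma card_points n : #|points p n| = n.
Proof.
rewrite card_tagged sumnE big_map big_enum /=.
under eq_bigr do rewrite card_Xpow.
by rewrite -[RHS]sum_expo [RHS](big_nth 0%N) big_mkord.
Qed.

Lemma card_Psyl n : #|Psyl p n| = (p ^ logn p n`!)%N.
Proof.
rewrite card_injm ?Pembed_inj // cardsT card_dep_ffun foldrE big_map big_enum /=.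
under eq_bigr do rewrite card_Ppow.
rewrite -expn_sum; congr expn.
by rewrite -(sum_digits_repunit (ltnSn n)) -big_expo [RHS](big_nth 0%N) big_mkord.
Qed.

Lemma Psyl_pSylow n : p.-Sylow([set: {perm points p n}]) (Psyl p n).
Proof.
have cardS : #|{perm points p n}| = n`!.
  rewrite -[in RHS](card_points n) -(cardsT (points p n)) -card_perm.
  by apply: eq_card => s; apply/esym/subsetP=> x _; rewrite inE.
by rewrite pHallE subsetT card_Psyl cardsT cardS p_part /=.
Qed.

End Sylow.

(* Main.v *)
Require Import Defs.
From HB Require Import structures.
From mathcomp Require Import all_boot all_order all_fingroup all_algebra.
From mathcomp Require Import all_solvable all_field all_character.
From mathcomp Require Import zify.

(** For a set A of points let P_A be the pointwise stabiliser of A in P_n, and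
    call A fixing for theta if theta, restricted to P_A, contains the trivial
    character.  The two halves of the proof meet in the number

      b(theta) = the least size of a set that is fixing for theta,

    namely: the longest first row of a partition in Omega(theta) is n - b(theta),
    no first column is longer, and b(theta) = gamma_0(theta).

    The first half concerns any subgroup P of the alternating group of the
    points; the Sylow subgroup is one because its order is odd.  Write r and c for
    the row symmetriser and the column antisymmetriser of la, and f for the
    element of the group algebra of P that projects, up to a scalar, on the
    theta-isotypic component.  An irreducible representation chi lies in the
    Specht character of la iff r c acts on it nontrivially ([specht_constt]), and
    its restriction contains theta iff f acts nontrivially ([isotypic_neq0]).  As
    the image of the group spans all matrices, two nonzero matrices A and B have
    A chi(g) B <> 0 for some g ([irr_mulmx_neq0]).  Applied to r and f, this turns
    r into the symmetriser over a conjugate Young subgroup; the elements of P that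
    fix every point outside the conjugate of the first row lie in that subgroup,
    so the complement of the conjugate of the first row is a fixing set of size
    n - la_1.  The same argument applied to c, whose conjugate is fixed by these
    elements because they are even permutations, gives the bound for columns
    ([specht_fixed_sum]).  Conversely, if A is fixing, then the sum h over the
    permutations that fix A pointwise has h f <> 0, so some irreducible chi has
    chi(h) <> 0 and chi(f) <> 0.  It lies in a Specht character, and
    chi(r c) chi(g) chi(h) <> 0 forces the n - |A| points outside A, moved by a
    permutation, into different columns of la, whence la_1 >= n - |A|
    ([fixed_sum_specht]).

    That every irreducible character lies in a Specht character
    ([irr_young_symmetrizer]) is a counting argument: choose for each la an
    irreducible W(la) on which r c acts nontrivially.  If W(la) = W(mu), the rows
    of one diagram are transversal to the columns of the other and vice versa, so
    la and mu dominate each other; hence W is injective, and there are at most as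
    many conjugacy classes as partitions because the cycle type determines the
    class.

    The second half is an induction over the tower of wreath products.  A
    nonempty set is stabilised pointwise only by elements of the base group, where
    the fixing condition splits over the factors: b is additive over direct
    products, b of the character induced from a mixed product th_1 x ... x th_p
    is the sum of the b(th_i), and b(X(phi; eps)) = p b(phi), except that
    b(X(1; eps)) = 1 for eps <> 0, since then the empty set is not fixing but a
    single point is.  The statistic gamma_0 satisfies the same recursion
    ([gamma0_treeS]): a person at the root counts exactly when there is no person
    below, that is when gamma_0 vanishes on all the subtrees. *)

Set Implicit Arguments.
Unset Strict Implicit.
Unset Printing Implicit Defensive.

Import Order.TTheory GroupScope GRing.Theory Num.Theory.
Local Open Scope ring_scope.

(** * The group algebra acting on representations *)

Section GroupAlgebra.

Variable gT : finGroupType.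
Implicit Types (u v : gT -> algC) (g : gT) (i : Iirr [set: gT]).

(** The group algebra is modelled by plain functions on the group, so that class
    functions and indicator functions can be used as its elements directly. *)
Definition alg_op d (rG : mx_representation algC [set: gT] d) u : 'M[algC]_d :=
  \sum_x u x *: rG x.

Definition alg_conv u v : gT -> algC := fun y => \sum_x u x * v (x^-1 * y)%g.

Section OneRepr.

Variables (d : nat) (rG : mx_representation algC [set: gT] d).
Local Notation op := (alg_op rG).

Lemma alg_opMl g u : rG g *m op u = op (fun y => u (g^-1 * y)%g).
Proof.
rewrite /alg_op mulmx_sumr [RHS](reindex_inj (mulgI g)).
by apply: eq_bigr => x _; rewrite mulKg -scalemxAr repr_mxM ?inE.
Qed.

Lemma alg_opMr g u : op u *m rG g = op (fun y => u (y * g^-1)%g).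
Proof.
rewrite /alg_op mulmx_suml [RHS](reindex_inj (mulIg g)).
by apply: eq_bigr => x _; rewrite mulgK -scalemxAl repr_mxM ?inE.
Qed.

Lemma alg_opM u v : op u *m op v = op (alg_conv u v).
Proof.
rewrite {1}/alg_op mulmx_suml.
under eq_bigr do rewrite -scalemxAl alg_opMl scaler_sumr.
rewrite exchange_big; apply: eq_bigr => y _; rewrite scaler_suml.
by apply: eq_bigr => x _; rewrite scalerA.
Qed.

Lemma tr_alg_op u : \tr (op u) = \sum_x u x * cfRepr rG x.
Proof.
rewrite /alg_op raddf_sum; apply: eq_bigr => x _.
by rewrite /= mxtraceZ cfunE inE mulr1n.
Qed.

Lemma eq_alg_op u v : u =1 v -> op u = op v.
Proof. by move=> eq_uv; apply: eq_bigr => x _; rewrite eq_uv. Qed.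

Lemma alg_opZ c u : op (fun x => c * u x) = c *: op u.
Proof. by rewrite scaler_sumr; apply: eq_bigr => x _; rewrite scalerA. Qed.

Lemma alg_op0 : op (fun=> 0) = 0.
Proof. by apply: big1 => x _; rewrite scale0r. Qed.

End OneRepr.

Lemma alg_op_regular d (rG : mx_representation algC [set: gT] d) u :
  gring_op rG (alg_op (regular_repr algC [set: gT]) u) = alg_op rG u.
Proof.
rewrite linear_sum; apply: eq_bigr => x _.
by rewrite linearZ /= gring_opG ?inE.
Qed.

(** A nonzero multiple of an idempotent is detected by its trace, because in
    characteristic 0 the trace of an idempotent is its rank.  This is what lets
    character values decide whether a matrix vanishes. *)
Lemma trace_quasi_idem d (E : 'M[algC]_d) c :
  E *m E = c *: E -> c != 0 -> E != 0 -> \tr E != 0.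
Proof.
move=> EE c0 E0; pose F := c^-1 *: E.
have FF : F *m F = F.
  by rewrite -scalemxAl -scalemxAr EE !scalerA mulrAC mulrK ?unitfE // mulVf ?mul1r // mulKf.
suff tF : \tr F = (\rank F)%:R.
  have : \tr F != 0.
    by rewrite tF pnatr_eq0 mxrank_eq0 scaler_eq0 invr_eq0 (negPf c0).
  by rewrite mxtraceZ mulf_eq0 negb_or => /andP[].
have /row_freeP[R' RR'] := row_base_free F.
have /row_fullP[C' C'C] := col_base_full F.
move: (mulmx_base F) R' RR' C' C'C; move: (row_base F) (col_base F).
move: (\rank F) => r R C defF R' RR' C' C'C.
have RC : R *m C = 1%:M.
  have := FF; rewrite -defF => /(congr1 (fun M => C' *m M *m R')).
  by rewrite /= -!mulmxA RR' mulmx1 !(mulmxA C') C'C !mul1mx.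
by rewrite -defF mxtrace_mulC RC mxtrace1.
Qed.

(** Burnside's theorem: the matrices ['Chi_i g] span the full matrix algebra, in
    which A X B = 0 for all X forces A = 0 or B = 0. *)
Lemma irr_mulmx_neq0 i m n (A : 'M_(m, _)) (B : 'M_(_, n)) :
  A != 0 -> B != 0 -> exists g, A *m 'Chi_i g *m B != 0.
Proof.
move=> A0 B0.
have /mx_abs_irrP[_ [a aE]] : mx_absolutely_irreducible 'Chi_i.
  by apply: groupC; exact: socle_irr.
have /existsP[g] : [exists g, A *m 'Chi_i g *m B != 0]; last by exists g.
apply: contraR A0; rewrite negb_exists => /forallP AB0.
have AXB X : A *m X *m B = 0.
  rewrite [X]aE mulmx_sumr mulmx_suml big1 // => x _.
  by rewrite -scalemxAr -scalemxAl (eqP (negbNE (AB0 x))) scaler0.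
have [k /eqP Bk] : exists k, ~~ (row k B == 0).
  apply/existsP; rewrite -negb_forall; apply: contra B0 => /forallP B0.
  by apply/eqP/row_matrixP=> k; rewrite row0; apply/eqP.
have [l /eqP Bkl] : exists l, ~~ (B k l == 0).
  apply/existsP; rewrite -negb_forall; apply/negP=> /forallP B1.
  by apply: Bk; apply/rowP=> l; rewrite !mxE; apply/eqP.
apply/eqP/matrixP=> x y; rewrite [RHS]mxE.
have := congr1 (fun M : 'M_(_, _) => M x l) (AXB (delta_mx y k)).
rewrite -(mul_delta_mx (0 : 'I_1)) !mulmxA -mulmxA -colE -rowE !mxE big_ord1 !mxE.
by move/eqP; rewrite mulf_eq0 => /orP[/eqP //|/eqP].
Qed.

Section Subgroup.

Variables (P : {group gT}).

Lemma tr_isotypic d (rG : mx_representation algC [set: gT] d) (th : 'CF(P)) :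
  th \is a character ->
  \tr (alg_op rG (fun x => th x^-1%g)) = #|P|%:R * '['Res[P] (cfRepr rG), th].
Proof.
move=> thN; rewrite tr_alg_op cfdotE mulrA divff ?mul1r; last first.
  by rewrite pnatr_eq0 -lt0n cardG_gt0.
rewrite (bigID (mem P)) /= [X in _ + X]big1 ?addr0 => [|x P'x]; last first.
  by rewrite cfun0 ?groupV ?mul0r.
by apply: eq_bigr => x Px; rewrite cfResE ?subsetT // char_inv // mulrC.
Qed.

(** The convolution of an irreducible character with itself is a multiple of it,
    so f is a scalar multiple of the projection on the isotypic component. *)
Lemma isotypic_idem d (rG : mx_representation algC [set: gT] d) (j : Iirr P)
    (f := alg_op rG (fun x => 'chi_j x^-1%g)) :
  f *m f = (#|P|%:R / 'chi_j 1%g) *: f.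
Proof.
rewrite alg_opM -alg_opZ; apply: eq_alg_op => y; rewrite /alg_conv.
have P0 : #|P|%:R != 0 :> algC by rewrite pnatr_eq0 -lt0n cardG_gt0.
have -> : #|P|%:R / 'chi_j 1%g * 'chi_j y^-1%g
    = \sum_(x in P) 'chi_j (x * y^-1)%g * 'chi_j x^-1%g.
  have := generalized_orthogonality_relation y^-1 j j.
  rewrite eqxx mul1r mulrAC -mulrA => <-.
  by rewrite mulrA mulfV // mul1r.
rewrite (bigID (mem P)) /= [X in _ + X]big1 ?addr0 => [|x P'x]; last first.
  by rewrite cfun0 ?groupV ?mul0r.
rewrite (reindex_inj invg_inj) [RHS](reindex_inj invg_inj) /=.
apply: eq_big => [x|x]; rewrite groupV // => Px.
rewrite !invgK mulrC; congr (_ * _).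
rewrite invMg -[in RHS](cfunJ _ (x^-1 * y^-1)%g (groupVr Px)).
by rewrite /conjg !mulgA invgK mulgV mul1g.
Qed.

(** The trace of the multiple f of the isotypic projection is #|P| times the
    multiplicity of the character. *)
Lemma isotypic_neq0 d (rG : mx_representation algC [set: gT] d) (j : Iirr P) :
  (alg_op rG (fun x => 'chi_j x^-1%g) != 0) = ('['Res[P] (cfRepr rG), 'chi_j] != 0).
Proof.
have P0 : #|P|%:R != 0 :> algC by rewrite pnatr_eq0 -lt0n cardG_gt0.
have trE := tr_isotypic rG (irr_char j).
apply/idP/idP => [f0|]; last first.
  by apply: contraNneq => f0; have/esym/eqP := trE; rewrite f0 mxtrace0 mulf_eq0 (negPf P0).
have := trace_quasi_idem (isotypic_idem rG j) _ f0.
by rewrite trE mulf_eq0 mulf_eq0 invr_eq0 !negb_or P0 irr1_neq0 => /(_ isT).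
Qed.

End Subgroup.

(** The coefficients of the product of the sum over Q with f are the traces of
    Theta(y^-1) E, where Theta affords the character and E is the sum of Theta over
    Q; so E is nonzero, and being a multiple of an idempotent it has a nonzero trace. *)
Lemma irr_fixed_sum_neq0 (P Q : {group gT}) d
    (rG : mx_representation algC [set: gT] d) (j : Iirr P) :
  Q \subset P ->
  alg_op rG (fun x => (x \in Q)%:R) *m alg_op rG (fun x => 'chi_j x^-1%g) != 0 ->
  \sum_(x in Q) 'chi_j x != 0.
Proof.
move=> sQP nz; pose E := \sum_(x in Q) 'Chi_j x.
have trE A : \tr (A *m E) = \sum_(x in Q) \tr (A *m 'Chi_j x).
  by rewrite mulmx_sumr raddf_sum.
have chiE x : x \in P -> 'chi_j x = \tr ('Chi_j x).
  by move=> Px; rewrite -irrRepr cfunE Px mulr1n.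
have EE : E *m E = #|Q|%:R *: E.
  rewrite {1}/E mulmx_suml scaler_nat -sumr_const; apply: eq_bigr => x Qx.
  rewrite mulmx_sumr [RHS](reindex_inj (mulgI x)) /=.
  apply: eq_big => [y|y Qy]; first by rewrite groupMl.
  by rewrite repr_mxM ?(subsetP sQP).
suff E0 : E != 0.
  have /(_ _ E0) := trace_quasi_idem EE.
  rewrite pnatr_eq0 -lt0n cardG_gt0 => /(_ isT).
  rewrite -[E]mul1mx trE; congr (_ != 0); apply: eq_bigr => x Qx.
  by rewrite mul1mx chiE ?(subsetP sQP).
apply: contraNneq nz => E0; rewrite alg_opM.
rewrite -(alg_op0 rG); apply/eqP/eq_alg_op => y.
rewrite /alg_conv (bigID (mem Q)) /= [X in _ + X]big1 ?addr0; last first.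
  by move=> x /negPf->; rewrite mul0r.
have [Py|P'y] := boolP (y \in P); last first.
  apply: big1 => x Qx; rewrite cfun0 ?mulr0 // groupV groupMl //.
  by rewrite groupV (subsetP sQP).
transitivity (\sum_(x in Q) \tr ('Chi_j y^-1%g *m 'Chi_j x)); last first.
  by rewrite -trE E0 mulmx0 mxtrace0.
apply: eq_bigr => x Qx; have Px := subsetP sQP x Qx.
by rewrite Qx mul1r invMg invgK chiE ?repr_mxM ?groupM ?groupV.
Qed.

(** The sum is the coefficient of u v at the identity; it can be read off from
    the irreducible representations because the regular character, which is
    supported at the identity, is a combination of the irreducible ones. *)
Lemma irr_alg_op_separates u v :
  (forall i, alg_op 'Chi_i u *m alg_op 'Chi_i v = 0) ->
  \sum_x u x * v x^-1%g = 0.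
Proof.
move=> uv0; have /esym/eqP : \sum_i 'chi_i 1%g * \tr (alg_op 'Chi_i (alg_conv u v))
   = #|[set: gT]|%:R * \sum_x u x * v x^-1%g.
  under eq_bigr => i _ do rewrite tr_alg_op irrRepr mulr_sumr.
  rewrite exchange_big /= (bigD1 1%g) //= [X in _ + X]big1 ?addr0 => [|x x1].
    rewrite (eq_bigr (fun i => alg_conv u v 1%g * ('chi_i 1%g *: 'chi_i) 1%g)).
      rewrite -mulr_sumr -sum_cfunE -cfReg_sum cfRegE eqxx mulr1n mulrC.
      by congr (_ * _); apply: eq_bigr => x _; rewrite mulg1.
    by move=> i _; rewrite cfunE mulrCA.
  rewrite (eq_bigr (fun i => alg_conv u v x * ('chi_i 1%g *: 'chi_i) x)).
    by rewrite -mulr_sumr -sum_cfunE -cfReg_sum cfRegE (negPf x1) mulr0n mulr0.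
  by move=> i _; rewrite cfunE mulrCA.
rewrite [X in _ == X]big1 => [|i _]; last by rewrite -alg_opM uv0 mxtrace0 mulr0.
by rewrite mulf_eq0 pnatr_eq0 cardsT -cardsT -leqn0 leqNgt cardG_gt0 => /eqP.
Qed.

Section RightIdeal.

Variable w : gT -> algC.
Let aG := regular_repr algC [set: gT].
Let y := gring_row (alg_op aG w).
Local Notation val := (@val_submod _ _ (cyclic_mx aG y) _).

(** With e the element that projects on the isotypic component of ['chi_i], the
    multiplicity vanishes iff the right ideal w C[G] is killed by e; the
    coefficients of w g e are traces of products of ['Chi_i w] with group
    elements. *)
Lemma right_ideal_constt i :
  ('[cfRepr (submod_repr (cyclic_mx_module aG y)), 'chi_i] != 0)
  = (alg_op 'Chi_i w != 0).
Proof.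
rewrite -[X in '[X, _]]cfRes_id -isotypic_neq0.
set f := fun x => _; set rV := submod_repr _.
have valJ m (A : 'M_(m, _)) : val (A *m alg_op rV f) = val A *m alg_op aG f.
  rewrite !mulmx_sumr linear_sum; apply: eq_bigr => x _.
  by rewrite -!scalemxAr linearZ /= val_submodJ ?inE.
apply/idP/idP; apply: contraNneq.
  move=> w0; suff: val (alg_op rV f) = 0.
    by move=> V0; apply/eqP/val_submod_inj; rewrite V0 linear0.
  rewrite -[X in val X]mul1mx valJ; apply/row_matrixP=> k.
  rewrite row_mul row0.
  have /cyclic_mxP[A /envelop_mxP[a ->] ->] :
      (row k (val 1%:M) <= cyclic_mx aG y)%MS.
    by rewrite (submx_trans (row_sub _ _)) ?val_submod1.
  have -> : \sum_(x in [set: gT]) a x *: aG x = alg_op aG a.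
    by apply: eq_bigl => x; rewrite inE.
  rewrite -!gring_row_mul !alg_opM (@eq_alg_op _ aG _ (fun=> 0)) ?alg_op0 ?linear0 //.
  move=> z; transitivity (\tr ('Chi_i z^-1%g *m alg_op 'Chi_i (alg_conv w a))).
    rewrite alg_opMl tr_alg_op irrRepr (reindex_inj (mulgI z^-1)%g).
    by apply: eq_bigr => x _; rewrite /f invgK mulKVg invMg invgK.
  by rewrite -alg_opM w0 mul0mx mulmx0 mxtrace0.
move=> f0; apply/eqP; case: (eqVneq (alg_op 'Chi_i w) 0) => // w0.
have fi0 : alg_op 'Chi_i f != 0.
  by rewrite isotypic_neq0 irrRepr cfRes_id cfnorm_irr oner_eq0.
have [g /eqP[]] := irr_mulmx_neq0 w0 fi0.
rewrite alg_opMr alg_opM -alg_op_regular gring_opE -alg_opM -alg_opMr.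
rewrite !gring_row_mul.
have /submxP[B ->] : (y *m aG g <= val 1%:M)%MS.
  rewrite val_submod1; apply/cyclic_mxP; exists (aG g) => //.
  by apply: envelop_mx_id; rewrite inE.
by rewrite -mulmxA -valJ mul1mx f0 linear0 mulmx0 linear0.
Qed.

End RightIdeal.

End GroupAlgebra.

(** * Row symmetrisers, column antisymmetrisers and dominance *)

Section YoungSymmetrizers.

Variable T : finType.
Implicit Types (r c : T -> nat) (g s : {perm T}).

(** Row and column stabilisers, and also the pointwise stabiliser of a set of
    points, are stabilisers of all the fibres of a function. *)
Definition fiber_stab r : {set {perm T}} :=
  [set s : {perm T} | [forall x, r (s x) == r x]].

Lemma fiber_stabP r s : reflect (forall x, r (s x) = r x) (s \in fiber_stab r).
Proof. by rewrite inE; apply: (iffP forallP) => rs x; apply/eqP. Qed.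

Fact fiber_stab_group_set r : group_set (fiber_stab r).
Proof.
apply/group_setP; split=> [|s t /fiber_stabP rs /fiber_stabP rt].
  by apply/fiber_stabP=> x; rewrite perm1.
by apply/fiber_stabP=> x; rewrite permM rt.
Qed.
Canonical fiber_stab_group r := Group (fiber_stab_group_set r).

Lemma tperm_fiber_stab r x y : r x = r y -> tperm x y \in fiber_stab r.
Proof. by move=> rxy; apply/fiber_stabP=> z; case: tpermP => [->|->|]. Qed.

Definition fiber_sym r s : algC := (s \in fiber_stab r)%:R.
Definition fiber_alt c s : algC := (-1) ^+ s *+ (s \in fiber_stab c).

Lemma fiber_symM r s t : s \in fiber_stab r -> fiber_sym r (s * t)%g = fiber_sym r t.
Proof. by rewrite /fiber_sym => rs; rewrite groupMl. Qed.

Lemma fiber_altM c s t :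
  t \in fiber_stab c -> fiber_alt c (s * t)%g = (-1) ^+ t * fiber_alt c s.
Proof.
by rewrite /fiber_alt => ct; rewrite groupMr // odd_permM signr_addb mulrC mulrnAr.
Qed.

(** Row and column stabilisers of a tableau meet trivially, so the coefficient of
    their product at the identity is 1. *)
Lemma fiber_sym_alt_neq0 r c :
    (forall x y, r x = r y -> c x = c y -> x = y) ->
  exists i : Iirr [set: {perm T}],
    alg_op 'Chi_i (fiber_sym r) *m alg_op 'Chi_i (fiber_alt c) != 0.
Proof.
move=> inj_rc; apply/existsP.
apply: contraT; rewrite negb_exists => /forallP rc0; exfalso.
have /eqP := irr_alg_op_separates (fun i => eqP (negbNE (rc0 i))).
rewrite (bigD1 1%g) //= big1 => [|s s1].
  by rewrite /fiber_sym /fiber_alt invg1 !group1 odd_perm1 mulr1 addr0 oner_eq0.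
rewrite /fiber_sym /fiber_alt groupV.
case: fiber_stabP => [rs|_]; last by rewrite mul0r.
case: fiber_stabP => [cs|_]; last by rewrite mulr0.
case/eqP: s1; apply/permP=> x; rewrite perm1; exact: inj_rc.
Qed.

(** If two points in one fibre of c are moved by g into one fibre of r, their
    transposition is absorbed on the left with the sign -1 and, after
    conjugation by g, on the right with the sign 1; so the product is its own
    opposite. *)
Lemma fiber_alt_sym_transversal d (rG : mx_representation algC [set: {perm T}] d)
    c r g :
    alg_op rG (fiber_alt c) *m rG g *m alg_op rG (fiber_sym r) != 0 ->
  forall x y, c x = c y -> r (g x) = r (g y) -> x = y.
Proof.
move=> nz x y cxy rxy; apply/eqP; apply: contraNT nz => neq_xy.
have altJ : alg_op rG (fiber_alt c) *m rG (tperm x y) = - alg_op rG (fiber_alt c).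
  rewrite alg_opMr -scaleN1r -alg_opZ; apply: eq_alg_op => s.
  rewrite fiber_altM ?groupV ?tperm_fiber_stab //.
  by rewrite odd_permV odd_tperm neq_xy.
have symJ : rG (tperm x y ^ g)%g *m alg_op rG (fiber_sym r) = alg_op rG (fiber_sym r).
  rewrite alg_opMl; apply: eq_alg_op => s.
  by rewrite fiber_symM // groupV tpermJ tperm_fiber_stab.
set M := _ *m _ *m _.
(* Moving the transposition from the left factor across g to the right one. *)
have MN : M = - M.
  rewrite {1}/M -symJ -!mulmxA (mulmxA (rG g)) -repr_mxM ?inE // -conjgC.
  by rewrite repr_mxM ?inE // !mulmxA altJ !mulNmx.
have /eqP : 2%:R *: M = 0 by rewrite scaler_nat mulr2n {1}MN addNr.
by rewrite scaler_eq0 pnatr_eq0.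
Qed.

Lemma irr_sym_alt_transversal (i : Iirr [set: {perm T}]) r c r' :
    alg_op 'Chi_i (fiber_sym r) *m alg_op 'Chi_i (fiber_alt c) != 0 ->
    alg_op 'Chi_i (fiber_sym r') != 0 ->
  exists g : {perm T}, forall x y, c x = c y -> r' (g x) = r' (g y) -> x = y.
Proof.
move=> rc0 r'0; have [g nz] := irr_mulmx_neq0 rc0 r'0; exists g.
apply: (@fiber_alt_sym_transversal _ 'Chi_i).
by apply: contraNneq nz => cr'0; rewrite -(mulmxA _ _ ('Chi_i g)) -mulmxA cr'0 mulmx0.
Qed.

Lemma card_le_label (A : {set T}) (f : T -> nat) n :
  {in A &, injective f} -> {in A, forall x, f x < n}%N -> (#|A| <= n)%N.
Proof.
move=> inj_f ltf; rewrite cardE -(size_map f) -[leqRHS](size_iota 0).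
apply: uniq_leq_size => [|j /mapP[x]]; last first.
  by rewrite mem_enum => Ax ->; rewrite mem_iota ltf.
rewrite map_inj_in_uniq ?enum_uniq // => x y.
by rewrite !mem_enum; apply: inj_f.
Qed.

Lemma card_ge_label (A : {set T}) (f : T -> nat) n :
  (forall j, (j < n)%N -> exists2 x, x \in A & f x = j) -> (n <= #|A|)%N.
Proof.
move=> surj_f; rewrite cardE -(size_map f) -[leqLHS](size_iota 0).
apply: uniq_leq_size (iota_uniq _ _) _ => j.
rewrite mem_iota => /surj_f[x Ax <-]; apply: map_f; by rewrite mem_enum.
Qed.

Section Tableau.

Variable la : seq nat.
Hypothesis sum_la : sumn la = #|T|.

Let rank_lt (x : T) : (enum_rank x < sumn la)%N.
Proof. by rewrite sum_la. Qed.

Lemma tab_col_lt (x : T) : (tab_col la x < nth 0%N la (tab_row la x))%N.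
Proof. exact: reshape_offsetP. Qed.

Lemma tab_row_lt (x : T) : (tab_row la x < size la)%N.
Proof. exact: reshape_indexP. Qed.

Lemma tab_inj (x y : T) : tab_row la x = tab_row la y -> tab_col la x = tab_col la y -> x = y.
Proof.
move=> rxy cxy; apply/enum_rank_inj/val_inj => /=.
by rewrite -(reshape_indexK la (enum_rank x)) -(reshape_indexK la (enum_rank y))
  -/(tab_row la x) -/(tab_col la x) rxy cxy.
Qed.

Lemma tab_surj i j :
  (j < nth 0%N la i)%N -> exists2 x : T, tab_row la x = i & tab_col la x = j.
Proof.
move=> lt_j; have := flatten_indexP lt_j; rewrite sum_la => lt_ij.
exists (enum_val (Ordinal lt_ij)); rewrite /tab_row /tab_col enum_valK /=.
  exact: flatten_indexKl.
exact: flatten_indexKr.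
Qed.

Lemma card_tab_row i : #|[set x : T | tab_row la x == i]| = nth 0%N la i.
Proof.
apply/eqP; rewrite eqn_leq; apply/andP; split.
  apply: (@card_le_label _ (tab_col la)) => [x y|x]; rewrite !inE.
    by move=> /eqP rx /eqP ry; apply: tab_inj; rewrite rx ry.
  by move=> /eqP <-; exact: tab_col_lt.
apply: (@card_ge_label _ (tab_col la)) => j lt_j.
by have [x rx cx] := tab_surj lt_j; exists x; rewrite ?inE ?rx.
Qed.

Hypothesis sorted_la : sorted geq la.

Lemma nth_sorted_geq i j : (i <= j)%N -> (nth 0 la j <= nth 0 la i)%N.
Proof.
move=> le_ij; have [lt_j|/(nth_default _)-> //] := ltnP j (size la).
apply: (sorted_leq_nth (leT := geq)) => //; rewrite ?inE //.
- by move=> y x z; rewrite /geq /= => xy yz; apply: leq_trans yz xy.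
- by move=> x; exact: leqnn.
exact: leq_ltn_trans lt_j.
Qed.

(** Dominance, proved column by column: the points of column j with r-label below
    k have different labels, so there are at most k of them, and at most as many
    as the column is long; the first k rows of the column attain the smaller of
    the two bounds. *)
Lemma card_transversal_rows (r : T -> nat) (g : {perm T}) k :
    (forall x y, tab_col la x = tab_col la y -> r (g x) = r (g y) -> x = y) ->
  (#|[set x | r x < k]| <= #|[set x : T | tab_row la x < k]|)%N.
Proof.
move=> transv.
have -> : #|[set x | (r x < k)%N]| = #|[set x | (r (g x) < k)%N]|.
  rewrite -[RHS](card_imset _ (@perm_inj _ g)); apply: eq_card => y.
  rewrite inE; apply/idP/imsetP => [rk|[x]]; last by rewrite inE => rk ->.
  by exists (g^-1 y)%g; rewrite ?inE permKV.
have split_col (P : pred T) :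
    #|[set x | P x]| = (\sum_(j < #|T|.+1) #|[set x | P x && (tab_col la x == j)]|)%N.
  rewrite -sum1_card (partition_big (fun x => inord (tab_col la x) : 'I_#|T|.+1) predT) //=.
  apply: eq_bigr => j _; rewrite -[RHS]sum1_card; apply: eq_bigl => x; rewrite !inE.
  congr (_ && _); rewrite -val_eqE /= inordK // ltnS.
  rewrite (leq_trans (ltnW (tab_col_lt x))) // -card_tab_row; exact: max_card.
(* Column j is either full up to row k or ends above it. *)
rewrite (split_col (fun x => r (g x) < k)%N) (split_col (fun x => tab_row la x < k)%N).
apply: leq_sum => j _.
have [full|/forallPn[i]] := boolP [forall i : 'I_k, (j < nth 0 la i)%N].
  apply: (@leq_trans k).
    apply: (@card_le_label _ (fun x => r (g x))) => [x y|x]; rewrite !inE.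
      by move=> /andP[_ /eqP cx] /andP[_ /eqP cy]; apply: transv; rewrite cx cy.
    by case/andP.
  apply: (@card_ge_label _ (tab_row la)) => i lt_i.
  have [x rx cx] := tab_surj (forallP full (Ordinal lt_i)).
  by exists x; rewrite ?inE ?rx ?cx ?lt_i ?eqxx.
rewrite -leqNgt => le_j; apply/subset_leq_card/subsetP=> x; rewrite !inE.
case/andP=> _ /eqP cx; rewrite cx eqxx andbT ltnNge.
apply/negP => le_k; have := tab_col_lt x; rewrite cx ltnNge; case/negP.
by apply: leq_trans le_j; apply: nth_sorted_geq; apply: leq_trans le_k; apply: ltnW.
Qed.

Lemma card_tab_col0 : all (fun m => 0 < m)%N la ->
  #|[set x : T | tab_col la x == 0]| = size la.
Proof.
move=> la_gt0; apply/eqP; rewrite eqn_leq; apply/andP; split.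
  apply: (@card_le_label _ (tab_row la)) => [x y|x]; rewrite !inE.
    by move=> /eqP cx /eqP cy rxy; apply: tab_inj; rewrite ?cx.
  by move=> _; exact: tab_row_lt.
apply: (@card_ge_label _ (tab_row la)) => i lt_i.
have [x rx cx] := tab_surj (allP la_gt0 _ (mem_nth 0%N lt_i)).
by exists x; rewrite ?inE ?cx.
Qed.

End Tableau.

End YoungSymmetrizers.

(** * Cycle types and completeness of the Specht characters *)

Section CycleType.

Variable T : finType.
Implicit Types s t : {perm T}.

Definition cycle_type s : seq nat :=
  sort geq [seq fingraph.order s x | x <- enum (froots s)].

Let cyc s : connect_sym (frel s) := fconnect_sym (@perm_inj _ s).

Lemma sumn_cycle_type s : sumn (cycle_type s) = #|T|.
Proof.
rewrite (perm_sumn (permEl (perm_sort _ _))) sumnE big_map big_enum /=.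
rewrite -sum1_card [RHS](partition_big (froot s) (froots s)) /= => [|x _]; last first.
  exact: roots_root.
apply: eq_bigr => x /eqP root_x.
rewrite /fingraph.order -sum1_card; apply: eq_bigl => y.
by rewrite -[x in _ == x]root_x root_connect // cyc.
Qed.

Lemma cycle_type_gt0 s : all (fun m => 0 < m)%N (cycle_type s).
Proof.
rewrite /cycle_type all_sort all_map; apply/allP=> x _; exact: fingraph.order_gt0.
Qed.

Lemma sorted_cycle_type s : sorted geq (cycle_type s).
Proof. by apply: sort_sorted => x y; apply: leq_total. Qed.

(** A bijection between the cycles of s and those of t that preserves lengths,
    together with a base point on each cycle, determines a conjugating
    permutation: it sends the k-th iterate of a base point to the k-th iterate of
    the matching base point. *)
Lemma cycle_type_conj s t : cycle_type s = cycle_type t -> exists w, t = (s ^ w)%g.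
Proof.
move=> eq_st.
have [F [rootF ordF injF]] : exists F : T -> T,
    [/\ {in froots s, forall b, F b \in froots t},
        {in froots s, forall b, fingraph.order t (F b) = fingraph.order s b}
      & {in froots s &, injective F}].
  have : perm_eq [seq fingraph.order s x | x <- enum (froots s)]
                 [seq fingraph.order t x | x <- enum (froots t)].
    by apply/(perm_sortP (leT := geq)) => // [x y|y x z|x y];
      rewrite ?leq_total // /geq /=; lia.
  case/(perm_iotaP 0%N) => js; rewrite size_map => perm_js def_ord.
  have size_js : size js = size (enum (froots s)).
    by rewrite -(size_map (fingraph.order s)) def_ord size_map.
  have lt_js k : (k < size js)%N -> (nth 0 js k < size (enum (froots t)))%N.
    by move=> lt_k; have := mem_nth 0%N lt_k; rewrite (perm_mem perm_js) mem_iota.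
  exists (fun b => nth b (enum (froots t)) (nth 0%N js (index b (enum (froots s))))).
  have idx b : b \in froots s -> (index b (enum (froots s)) < size js)%N.
    by move=> root_b; rewrite size_js index_mem mem_enum.
  split=> [b|b|b b'] root_b.
  - by rewrite -mem_enum mem_nth ?lt_js ?idx.
  - have lt_b := idx b root_b.
    have := congr1 (fun l => nth 0%N l (index b (enum (froots s)))) def_ord.
    rewrite (nth_map b) -?size_js // nth_index ?mem_enum // => ->.
    by rewrite (nth_map 0%N) // (nth_map b) // lt_js.
  move=> root_b'; rewrite (set_nth_default b) ?lt_js ?idx // => /eqP.
  rewrite nth_uniq ?lt_js ?idx ?enum_uniq // nth_uniq ?idx //; last first.
    by rewrite (perm_uniq perm_js) iota_uniq.
  by move/eqP/(congr1 (nth b (enum (froots s)))); rewrite !nth_index ?mem_enum.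
(* u sends the k-th iterate of the base point b to the k-th iterate of F b. *)
pose u x := iter (findex s (froot s x) x) t (F (froot s x)).
have rootb x : froot s x \in froots s by exact: roots_root.
have conb x : fconnect s (froot s x) x by rewrite cyc connect_root.
have inj_u : injective u.
  move=> x y eq_u.
  have eq_root : froot s x = froot s y.
    apply: injF => //; rewrite -[LHS](eqP (rootF _ _)) // -[RHS](eqP (rootF _ _)) //.
    apply/eqP; rewrite (root_connect (cyc t)); apply: (connect_trans (y := u x)).
      exact: fconnect_iter.
    by rewrite eq_u (cyc t); exact: fconnect_iter.
  have /(congr1 (findex t (F (froot s x)))) := eq_u.
  rewrite /u -eq_root !findex_iter ?ordF ?findex_max //; last by rewrite eq_root.
  move=> eq_idx; rewrite -(iter_findex (conb x)) eq_idx eq_root; exact: iter_findex.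
have comm_u x : u (s x) = t (u x).
  have eq_root : froot s (s x) = froot s x.
    by apply/esym/eqP; rewrite (root_connect (cyc s)); exact: fconnect1.
  rewrite /u eq_root; set b := froot s x; set k := findex s b x.
  have lt_k : (k < fingraph.order s b)%N by exact: findex_max (conb x).
  have -> : s x = iter k.+1 s b by rewrite iterS /k /b (iter_findex (conb x)).
  rewrite -[RHS]iterS; move: lt_k; rewrite leq_eqVlt => /orP[/eqP eq_k|lt_k].
    rewrite eq_k iter_order ?findex0 /=; last exact: perm_inj.
    by rewrite -(ordF b (rootb x)) iter_order; last exact: perm_inj.
  by rewrite findex_iter.
exists (perm inj_u); apply/permP=> y.
by rewrite -[y](permKV (perm inj_u)) permJ !permE comm_u.
Qed.

End CycleType.

Lemma partition_ofP n (la : seq nat) :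
    sorted geq la -> all (fun m => 0 < m)%N la -> sumn la = n ->
  exists p : partition_of n, parts p = la.
Proof.
move=> sorted_la la_gt0 sum_la.
have size_la : (size la <= n)%N.
  rewrite -sum_la; elim: la la_gt0 {sorted_la sum_la} => //= m la IHla /andP[m_gt0].
  by move/IHla=> le_la; rewrite -add1n leq_add.
have valK : map (val \o (inord : nat -> 'I_n.+1)) la = la.
  apply: map_id_in => m la_m; rewrite /= inordK // ltnS -sum_la.
  by elim: la la_m {sorted_la sum_la size_la la_gt0} => //= k la IHla;
    rewrite inE => /predU1P[->|/IHla le_m]; lia.
have bseq_la : (size (map (inord : nat -> 'I_n.+1) la) <= n)%N by rewrite size_map.
have val_la : is_partition (Bseq bseq_la).
  rewrite /is_partition /= -map_comp valK sorted_la sum_la eqxx andbT /=.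
  by rewrite -(all_map val (fun m => 0 < m)%N) -map_comp valK.
by exists (Sub (Bseq bseq_la) val_la); rewrite /parts SubK /= -map_comp valK.
Qed.

Lemma parts_spec n (la : partition_of n) :
  [/\ sorted geq (parts la), all (fun m => 0 < m)%N (parts la) & sumn (parts la) = n].
Proof.
by case/and3P: (valP la) => sorted_la la_gt0 /eqP sum_la; split; rewrite // all_map.
Qed.

Lemma parts_inj n : injective (@parts n).
Proof. by move=> la mu eq_p; apply/val_inj/val_inj/(inj_map val_inj). Qed.

Section Completeness.

Variables (T : finType) (n : nat).
Hypothesis cardT : #|T| = n.
Local Notation S_T := [set: {perm T}].

Lemma card_classes_partitions : (#|classes S_T| <= #|partition_of n|)%N.
Proof.
have type_ex (s : {perm T}) : exists la : partition_of n, parts la == cycle_type s.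
  have [la <-] := partition_ofP (sorted_cycle_type s) (cycle_type_gt0 s)
    (etrans (sumn_cycle_type s) cardT).
  by exists la.
pose type (C : {set {perm T}}) := xchoose (type_ex (repr C)).
rewrite -(card_in_imset (f := type)) ?max_card // => C D.
case/repr_classesP=> _ defC /repr_classesP[_ defD] eqCD.
have := xchooseP (type_ex (repr C)); rewrite -/(type C) eqCD => /eqP typeC.
have := xchooseP (type_ex (repr D)); rewrite -/(type D) => /eqP typeD.
have [w defw] := cycle_type_conj (etrans (esym typeC) typeD).
by rewrite defC defD defw classGidl ?inE.
Qed.

Let sum_parts (la : partition_of n) : sumn (parts la) = #|T|.
Proof. by rewrite cardT; have [] := parts_spec la. Qed.

Lemma eq_parts_rows (la mu : partition_of n) :
    (forall k, #|[set x : T | tab_row (parts la) x < k]|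
             = #|[set x : T | tab_row (parts mu) x < k]|)%N ->
  la = mu.
Proof.
move=> eq_lt; apply: parts_inj.
have cardS (nu : partition_of n) k : (#|[set x : T | tab_row (parts nu) x < k.+1]|
    = #|[set x : T | tab_row (parts nu) x < k]| + nth 0 (parts nu) k)%N.
  rewrite -(card_tab_row (sum_parts nu)) -cardsUI.
  rewrite [X in (_ + X)%N](_ : _ = 0%N) ?addn0.
    by apply: eq_card => x; rewrite !inE ltnS leq_eqVlt orbC.
  by apply: eq_card0 => x; rewrite !inE andbC; case: eqP => //= ->; rewrite ltnn.
have eq_nth k : nth 0%N (parts la) k = nth 0%N (parts mu) k.
  by apply/eqP; have := cardS la k; rewrite !eq_lt cardS => /eqP; rewrite eqn_add2l eq_sym.
have le_size (nu nu' : partition_of n) :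
    nth 0%N (parts nu) =1 nth 0%N (parts nu') -> (size (parts nu) <= size (parts nu'))%N.
  move=> eq_nu; rewrite leqNgt; apply/negP=> lt_size.
  have [_ /all_nthP gt0 _] := parts_spec nu.
  by have := gt0 0%N _ lt_size; rewrite eq_nu nth_default.
apply: (@eq_from_nth _ 0%N) => // ; apply/eqP; rewrite eqn_leq.
by rewrite !le_size // => k; rewrite eq_nth.
Qed.

(** Two partitions that select the same irreducible character dominate each other,
    so the selection is injective; it is onto since there are no more conjugacy
    classes than partitions. *)
Theorem irr_young_symmetrizer (i : Iirr S_T) : exists la : partition_of n,
  alg_op 'Chi_i (fiber_sym (tab_row (parts la)))
    *m alg_op 'Chi_i (fiber_alt (tab_col (parts la))) != 0.
Proof.
have sym_ex (la : partition_of n) := fiber_sym_alt_neq0 (@tab_inj T (parts la)).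
pose W la := xchoose (sym_ex la).
suff inj_W : injective W.
  have /codomP[la defi] : i \in codom W.
    apply: inj_card_onto inj_W _ _; rewrite card_ord NirrE.
    exact: card_classes_partitions.
  by exists la; rewrite defi; exact: (xchooseP (sym_ex la)).
have le_rows la mu k : W la = W mu -> (#|[set x : T | tab_row (parts mu) x < k]|
    <= #|[set x : T | tab_row (parts la) x < k]|)%N.
  move=> eqW; have la0 := xchooseP (sym_ex la); rewrite -/(W la) in la0.
  have mu0 : alg_op 'Chi_(W la) (fiber_sym (tab_row (parts mu))) != 0.
    have := xchooseP (sym_ex mu); rewrite -/(W mu) -eqW.
    by apply: contraNneq => ->; rewrite mul0mx.
  have [g transv] := irr_sym_alt_transversal la0 mu0.
  by apply: card_transversal_rows transv; case: (parts_spec la).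
move=> la mu eqW; apply: eq_parts_rows => k.
by apply/eqP; rewrite eqn_leq !le_rows.
Qed.

End Completeness.

(** * Constituents of restricted Specht characters and fixing sets *)

Section SpechtRestriction.

Variables (T : finType) (n : nat).
Hypothesis cardT : #|T| = n.
Local Notation S_T := [set: {perm T}].

Lemma specht_constt (la : seq nat) (i : Iirr S_T) :
  ('[specht_char T la, 'chi_i] != 0)
  = (alg_op 'Chi_i (fiber_sym (tab_row la)) *m alg_op 'Chi_i (fiber_alt (tab_col la)) != 0).
Proof.
rewrite alg_opM -right_ideal_constt -alg_opM /specht_char.
suff -> : young_symmetrizer T la = gring_row
   (alg_op (regular_repr algC S_T) (fiber_sym (tab_row la))
    *m alg_op (regular_repr algC S_T) (fiber_alt (tab_col la))) by [].
congr (gring_row (_ *m _)); rewrite big_mkcond; apply: eq_bigr => s _.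
  by rewrite /fiber_sym -/(fiber_stab (tab_row la)); case: ifP => _; rewrite (scale1r, scale0r).
by rewrite /fiber_alt -/(fiber_stab (tab_col la)); case: ifP => _; rewrite // scale0r.
Qed.

Variables (P : {group {perm T}}) (j : Iirr P).

(** The sets A that arise are complements of conjugates of the fibre of r at 0,
    that is of the first row or the first column.  Elements of P that fix A
    pointwise are conjugate into the fibre stabiliser of r, so u absorbs them and
    their sum can be inserted between u and f. *)
Lemma coset_fixed_sum (i : Iirr S_T) (r : T -> nat) (u : {perm T} -> algC) :
    (forall s t, t \in P :^ s -> t \in fiber_stab r -> forall x, u (x * t)%g = u x) ->
    alg_op 'Chi_i u != 0 -> '['Res[P] 'chi_i, 'chi_j] != 0 ->
  exists2 A : {set T}, (#|A| + #|[set x | r x == 0%N]| = n)%N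
    & \sum_(x in 'C_P(A | 'P)) 'chi_j x != 0.
Proof.
move=> uJ u0; rewrite -(irrRepr i) -isotypic_neq0 => f0.
have [g nz] := irr_mulmx_neq0 u0 f0.
(* The complement of the image under g of the fibre at 0. *)
pose A := [set x | r (g^-1 x)%g != 0%N]; exists A.
  rewrite -cardT -(cardsC A); congr addn.
  rewrite -(card_imset _ (@perm_inj _ g)); apply: eq_card => y.
  rewrite !inE negbK; apply/imsetP/idP => [[x]|r0].
    by rewrite inE => rx ->; rewrite permK.
  by exists (g^-1 y)%g; rewrite ?inE ?permKV.
set Q := 'C_P(A | 'P)%G; have sQP : Q \subset P by exact: subsetIl.
apply: (@irr_fixed_sum_neq0 _ P Q _ 'Chi_i) => //.
apply: contraNneq nz => Qf0.
have fixQ x : x \in Q -> alg_op 'Chi_i u *m 'Chi_i g *m 'Chi_i x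
    = alg_op 'Chi_i u *m 'Chi_i g.
  case/setIP=> Px /astabP fix_xP.
  have fix_x z : z \in A -> x z = z by move/fix_xP.
  rewrite -mulmxA -repr_mxM ?inE // [(g * x)%g]conjgCV repr_mxM ?inE // mulmxA.
  congr (_ *m _); rewrite alg_opMr; apply: eq_alg_op => s.
  apply: (uJ g^-1%g); first by rewrite groupV memJ_conjg.
  rewrite groupV; apply/fiber_stabP=> y; rewrite conjgE invgK !permM.
  have [Ay|A'y] := boolP (g y \in A); first by rewrite fix_x // permK.
  have A'xy : x (g y) \notin A.
    apply: contra A'y => Axy; suff <- : x (g y) = g y by [].
    by apply: (@perm_inj _ x); rewrite fix_x.
  by move: A'y A'xy; rewrite !inE !negbK permK => /eqP-> /eqP->.
have : #|Q|%:R *: (alg_op 'Chi_i u *m 'Chi_i g) *m alg_op 'Chi_i (fun x => 'chi_j x^-1%g) = 0.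
  rewrite scaler_nat -sumr_const.
  under eq_bigr => x Qx do rewrite -(fixQ x Qx).
  rewrite -mulmx_sumr -!mulmxA.
  suff -> : \sum_(x in Q) 'Chi_i x = alg_op 'Chi_i (fun x => (x \in Q)%:R).
    by rewrite Qf0 !mulmx0.
  rewrite big_mkcond; apply: eq_bigr => x _.
  by case: ifP => _; rewrite (scale1r, scale0r).
by rewrite -scalemxAl => /eqP; rewrite scaler_eq0 pnatr_eq0 -leqn0 leqNgt cardG_gt0.
Qed.

(** The sum h over the permutations that fix A pointwise is a row symmetriser for
    the labelling with a single nontrivial fibre, the complement of A.  The
    coefficient of h f at the identity is the sum in the hypothesis. *)
Lemma fixed_sum_specht (A : {set T}) :
    \sum_(x in 'C_P(A | 'P)) 'chi_j x != 0 ->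
  exists2 la : partition_of n, '['Res[P] (specht_char T (parts la)), 'chi_j] != 0
    & (n - #|A| <= head 0 (parts la))%N.
Proof.
(* r is injective on A with positive values, and 0 outside. *)
move=> fixA; pose r x : nat := if x \in A then (enum_rank x).+1 else 0%N.
have stab_r s : (s \in fiber_stab r) = (s \in 'C(A | 'P)).
  apply/fiber_stabP/astabP => /= fix_s x => [Ax|]; last first.
    have fix_sA z : z \in A -> s z = z by move/fix_s.
    have [Ax|A'x] := boolP (x \in A); first by rewrite fix_sA.
    rewrite /r (negPf A'x) ifN //; apply: contra A'x => Asx.
    suff <- : s x = x by [].
    by apply: (@perm_inj _ s); rewrite fix_sA.
  have := fix_s x; rewrite /r Ax apermE; case: ifP => // _ [].
  by move/val_inj/enum_rank_inj.
have [i] : exists i : Iirr S_T, alg_op 'Chi_i (fiber_sym r)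
    *m alg_op 'Chi_i (fun x => 'chi_j x^-1%g) != 0.
  apply/existsP; apply: contraR fixA; rewrite negb_exists => /forallP rf0.
  have := irr_alg_op_separates (fun i => eqP (negbNE (rf0 i))) => sum0.
  apply/eqP; rewrite -[RHS]sum0 big_mkcond; apply: eq_bigr => x _.
  rewrite invgK /fiber_sym stab_r in_setI.
  have [Px|P'x] := boolP (x \in P); last by rewrite cfun0 ?mulr0.
  by case: (x \in _); rewrite ?mul1r ?mul0r.
move=> rf0.
have r0 : alg_op 'Chi_i (fiber_sym r) != 0.
  by apply: contraNneq rf0 => ->; rewrite mul0mx.
have f0 : alg_op 'Chi_i (fun x => 'chi_j x^-1%g) != 0.
  by apply: contraNneq rf0 => ->; rewrite mulmx0.
have [la la0] := irr_young_symmetrizer cardT i; exists la.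
  rewrite -irr_consttE; apply: (constt_Res_trans (j := i)).
  - exact: cfRepr_char.
  - by rewrite irr_consttE specht_constt.
  by rewrite irr_consttE -(irrRepr i) -isotypic_neq0.
have [g transv] := irr_sym_alt_transversal la0 r0.
have [sorted_la _ sum_la] := parts_spec la.
have {}sum_la : sumn (parts la) = #|T| by rewrite sum_la.
have := card_transversal_rows sum_la sorted_la 1 transv.
have -> : #|[set x : T | (tab_row (parts la) x < 1)%N]| = head 0%N (parts la).
  by rewrite -nth0 -(card_tab_row sum_la); apply: eq_card => x; rewrite !inE ltnS leqn0.
suff -> : #|[set x | (r x < 1)%N]| = (n - #|A|)%N by [].
rewrite -cardT -(cardsC A) addKn; apply: eq_card => x; rewrite !inE /r.
by case: (x \in A).
Qed.

Hypothesis evenP : {in P, forall s : {perm T}, ~~ odd_perm s}.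

(** In the column case the elements of P enter the alternating sum with their
    sign; this is where P has to consist of even permutations. *)
Lemma specht_fixed_sum (la : partition_of n) :
    '['Res[P] (specht_char T (parts la)), 'chi_j] != 0 ->
  forall m, m = head 0%N (parts la) \/ m = size (parts la) ->
  exists2 A : {set T}, (#|A| + m = n)%N & \sum_(x in 'C_P(A | 'P)) 'chi_j x != 0.
Proof.
rewrite [specht_char _ _]cfun_sum_cfdot linear_sum cfdot_suml => nz m def_m.
have [i] : exists i : Iirr S_T, '[specht_char T (parts la), 'chi_i] != 0
    /\ '['Res[P] 'chi_i, 'chi_j] != 0.
  have /existsP[i] : [exists i : Iirr S_T, '['Res[P]
     ('[specht_char T (parts la), 'chi_i] *: 'chi_i), 'chi_j] != 0].
    apply: contraR nz; rewrite negb_exists => /forallP z.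
    by rewrite big1 // => i _; apply/eqP; rewrite -[_ == _]negbK; exact: z i.
  rewrite linearZ cfdotZl mulf_eq0 negb_or => /andP[]; by exists i.
rewrite specht_constt => -[yi0 Pi0].
have [sorted_la la_gt0 sum_la] := parts_spec la.
have {}sum_la : sumn (parts la) = #|T| by rewrite sum_la.
case: def_m => ->.
  rewrite -nth0 -(card_tab_row sum_la).
  apply: (@coset_fixed_sum i _ (fiber_sym (tab_row (parts la)))) => //.
    by move=> s t _ rt x; rewrite /fiber_sym groupMr.
  by apply: contraNneq yi0 => ->; rewrite mul0mx.
rewrite -(card_tab_col0 sum_la la_gt0).
apply: (@coset_fixed_sum i _ (fiber_alt (tab_col (parts la)))) => //.
  move=> s t Pt ct x; rewrite fiber_altM //.
  suff /negPf-> : ~~ odd_perm t by rewrite mul1r.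
  by have [y Py ->] := imsetP Pt; rewrite odd_permJ evenP.
by apply: contraNneq yi0 => ->; rewrite mulmx0.
Qed.

End SpechtRestriction.

(** * Characters of direct products *)

Section FixedSums.

Variable gT : finGroupType.

Lemma sum_group_char (G Q : {group gT}) (th : 'CF(G)) : Q \subset G ->
  \sum_(x in Q) th x = #|Q|%:R * '['Res[Q] th, 1].
Proof.
move=> sQG; rewrite cfdotE mulrA divff ?mul1r ?pnatr_eq0 -?lt0n ?cardG_gt0 //.
by apply: eq_bigr => x Qx; rewrite cfResE // cfun1E Qx conjC1 mulr1.
Qed.

Lemma sum_group_char_neq0 (G Q : {group gT}) (th : 'CF(G)) : Q \subset G ->
  (\sum_(x in Q) th x != 0) = (0 \in irr_constt ('Res[Q] th)).
Proof.
move=> sQG; rewrite sum_group_char // mulf_eq0 pnatr_eq0 (gtn_eqF (cardG_gt0 _)).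
by rewrite irr_consttE irr0.
Qed.

Lemma sum_group_char_ge0 (G Q : {group gT}) (th : 'CF(G)) :
  Q \subset G -> th \is a character -> 0 <= \sum_(x in Q) th x.
Proof.
move=> sQG Nth; rewrite sum_group_char // mulr_ge0 ?ler0n // natr_ge0 //.
by rewrite Cnat_cfdot_char ?cfRes_char ?rpred1.
Qed.

(** A vector fixed by Q is fixed by its subgroup R. *)
Lemma sum_group_char_sub (G Q R : {group gT}) (th : 'CF(G)) :
    R \subset Q -> Q \subset G -> th \is a character ->
  \sum_(x in Q) th x != 0 -> \sum_(x in R) th x != 0.
Proof.
move=> sRQ sQG Nth; rewrite !sum_group_char_neq0 ?(subset_trans sRQ) //.
move=> Q0; rewrite -(cfResRes _ sRQ sQG).
apply: (constt_Res_trans (cfRes_char _ Nth) Q0).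
by rewrite irr0 cfRes_cfun1 -irr0 irr_consttE cfnorm_irr oner_eq0.
Qed.

Lemma sum_irr_eq0 (j : Iirr [set: gT]) : (\sum_x 'chi_j x != 0) = (j == 0).
Proof.
have -> : \sum_x 'chi_j x = \sum_(x in [set: gT]%G) 'chi_j x.
  by apply: eq_bigl => x; rewrite inE.
by rewrite sum_group_char_neq0 // cfRes_id irr_consttE cfdot_irr pnatr_eq0 eqb0 negbK.
Qed.

End FixedSums.

(** Distributivity of a product over sums whose index types depend on the factor. *)
Lemma dffun_distr (I : finType) (T_ : I -> finType) (F : forall i, T_ i -> algC) :
  \sum_(k : {dffun forall i, T_ i}) \prod_i F i (k i) = \prod_i \sum_x F i x.
Proof.
under [RHS]eq_bigr => i _ do rewrite (big_tag F).
rewrite bigA_distr_big_dep /=.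
rewrite (reindex (@dffun_of_fprod _ T_)) /=; last exact/onW_bij/dffun_of_fprod_bij.
pose P_ i := [ffun x => F i x].
transitivity (\sum_(t : fprod T_) \prod_(i in I) P_ i (t i)).
  by apply: eq_bigr => t _; apply: eq_bigr => i _; rewrite /P_ !ffunE.
rewrite big_fprod; apply: eq_bigr => g fam_g; apply: eq_bigr => i _.
by rewrite /untag; case: eqP => // e; rewrite /P_ ffunE.
Qed.

Section CoordinateProduct.

Variables (aT : finGroupType) (D : {group aT}) (I : finType).
Variables (K : I -> finGroupType) (f : forall i, {morphism D >-> K i}).
Variable mk : {dffun forall i, K i} -> aT.
Hypothesis mkD : forall k, mk k \in D.
Hypothesis coord_mk : forall k i, f i (mk k) = k i.
Hypothesis coord_inj : {in D &, forall x y, (forall i, f i x = f i y) -> x = y}.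

Definition cf_coord (th : forall i, 'CF([set: K i])) : 'CF(D) :=
  \prod_i cfPull (f i) (th i).

Lemma cf_coordE th x : x \in D -> cf_coord th x = \prod_i th i (f i x).
Proof.
move=> Dx; rewrite /cf_coord prod_cfunE //.
apply: eq_bigr => i _; rewrite /cfPull cfMorphE ?subxx //.
by rewrite cfResE ?subsetT ?mem_morphim.
Qed.

Lemma sum_coord (F : forall i, K i -> algC) :
  \sum_(x in D) \prod_i F i (f i x) = \prod_i \sum_k F i k.
Proof.
rewrite -dffun_distr (reindex mk) /=.
  apply: eq_big => [k|k _]; first by rewrite mkD.
  by apply: eq_bigr => i _; rewrite coord_mk.
exists (fun x => [ffun i => f i x] : {dffun forall i, K i}) => [k _|x Dx].
  by apply/ffunP=> i; rewrite ffunE coord_mk.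
by apply: coord_inj => // i; rewrite coord_mk ffunE.
Qed.

Lemma cf_coord_fixed_sum (Q : {set aT}) (R : forall i, {set K i}) th :
    {in D, forall x, (x \in Q) = [forall i, f i x \in R i]} -> Q \subset D ->
  \sum_(x in Q) cf_coord th x = \prod_i \sum_(k in R i) th i k.
Proof.
move=> QE sQD; transitivity (\sum_(x in D) \prod_i
    (if f i x \in R i then th i (f i x) else 0)).
  rewrite big_mkcond [RHS]big_mkcond; apply: eq_bigr => x _.
  have [Dx|D'x] := boolP (x \in D); last by rewrite ifN // (contra (subsetP sQD x)).
  rewrite QE //; case: forallP => [Rx|nRx].
    by rewrite cf_coordE //; apply: eq_bigr => i _; rewrite Rx.
  have /forallPn[i Rix] : ~~ [forall i, f i x \in R i] by apply/forallP.
  by rewrite (bigD1 i) //= (negPf Rix) mul0r.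
rewrite (sum_coord (fun i k => if k \in R i then th i k else 0)).
by apply: eq_bigr => i _; rewrite -big_mkcond.
Qed.

Lemma cf_coord_char th :
  (forall i, th i \is a character) -> cf_coord th \is a character.
Proof.
by move=> Nth; apply: rpred_prod => i _; rewrite /cfPull cfMorph_char ?cfRes_char.
Qed.

Lemma card_coord : #|D|%:R = \prod_i #|[set: K i]|%:R :> algC.
Proof.
transitivity (\sum_(x in D) \prod_(i : I) (1 : algC)).
  by rewrite -sumr_const; apply: eq_bigr => x _; rewrite big1.
rewrite (sum_coord (fun i _ => 1)); apply: eq_bigr => i _.
by rewrite sumr_const cardsT.
Qed.

Lemma cfdot_coord th th' : '[cf_coord th, cf_coord th'] = \prod_i '[th i, th' i].
Proof.
rewrite cfdotE card_coord -prodfV.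
transitivity (\prod_i #|[set: K i]|%:R^-1 * \prod_i \sum_k th i k * (th' i k)^* : algC).
  congr (_ * _); rewrite -(sum_coord (fun i k => th i k * (th' i k)^*)).
  apply: eq_bigr => x Dx; rewrite !cf_coordE // rmorph_prod -big_split.
  by [].
rewrite -big_split; apply: eq_bigr => i _; rewrite cfdotE /=; congr (_ * _).
by apply: eq_big => k; rewrite ?inE.
Qed.

Lemma cf_coord_irr (phi : forall i, Iirr [set: K i]) :
  cf_coord (fun i => 'chi_(phi i)) \in irr D.
Proof.
rewrite irrEchar cf_coord_char => [|i]; last exact: irr_char.
by rewrite cfdot_coord big1 ?eqxx // => i _; rewrite cfnorm_irr.
Qed.

(** The products of irreducible characters exhaust the irreducible characters,
    because the regular character of a direct product is the product of the
    regular characters of the factors. *)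
Lemma irr_cf_coord (j : Iirr D) : exists phi : {dffun forall i, Iirr [set: K i]},
  'chi_j = cf_coord (fun i => 'chi_(phi i)).
Proof.
have regE : cfReg D = \sum_(phi : {dffun forall i, Iirr [set: K i]})
    (\prod_i 'chi_(phi i) 1%g) *: cf_coord (fun i => 'chi_(phi i)).
  apply/cfun_inP=> x Dx; rewrite sum_cfunE.
  transitivity (\prod_i \sum_l ('chi[[set: K i]]_l 1%g * 'chi_l (f i x))).
    transitivity (\prod_i cfReg [set: K i] (f i x)); last first.
      apply: eq_bigr => i _; rewrite cfReg_sum sum_cfunE.
      by apply: eq_bigr => l _; rewrite cfunE.
    have [->|x1] := eqVneq x 1%g.
      rewrite cfRegE eqxx mulr1n card_coord; apply: eq_bigr => i _.
      by rewrite morph1 cfRegE eqxx mulr1n.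
    rewrite cfRegE (negPf x1) mulr0n.
    have /existsP[i fix1] : [exists i, f i x != 1%g].
      apply: contraR x1; rewrite negb_exists => /forallP fx1; apply/eqP.
      by apply: coord_inj => // i; rewrite morph1; apply/eqP; rewrite -[_ == _]negbK.
    by rewrite (bigD1 i) //= cfRegE (negPf fix1) mul0r.
  rewrite -(dffun_distr (fun i (l : Iirr [set: K i]) => 'chi_l 1%g * 'chi_l (f i x))).
  by apply: eq_bigr => phi _; rewrite cfunE cf_coordE // big_split.
have : '[cfReg D, 'chi_j] != 0.
  by rewrite cfReg_sum cfdot_suml (bigD1 j) //= big1 ?addr0 => [|i ij];
    rewrite cfdotZl cfdot_irr ?eqxx ?(negPf ij) ?mulr1 ?irr1_neq0 ?mulr0.
rewrite regE cfdot_suml => nz.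
have /existsP[phi] : [exists phi : {dffun forall i, Iirr [set: K i]},
    '[cf_coord (fun i => 'chi_(phi i)), 'chi_j] != 0].
  apply: contraR nz; rewrite negb_exists => /forallP z.
  by rewrite big1 // => phi _; rewrite cfdotZl (eqP (negbNE (z phi))) mulr0.
have /irrP[l def_l] := cf_coord_irr phi; rewrite def_l => nz_l; exists phi; rewrite def_l.
by move: nz_l; rewrite cfdot_irr pnatr_eq0 eqb0 negbK => /eqP->.
Qed.

End CoordinateProduct.

(** * Minimal fixing sets, and direct products *)

(** The sum over a subgroup is its order times the multiplicity of the trivial
    character, so m is the least size of a set whose pointwise stabiliser has a
    nonzero fixed vector in a module affording th. *)
Definition min_fixing (gT : finGroupType) (X : finType) (to : {action gT &-> X})
    (th : 'CF([set: gT])) (m : nat) : Prop :=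
  (exists2 A : {set X}, #|A| = m & \sum_(x in 'C(A | to)) th x != 0)
  /\ (forall A : {set X}, \sum_(x in 'C(A | to)) th x != 0 -> (m <= #|A|)%N).

Section MinFixing.

Variables (gT : finGroupType) (X : finType) (to : {action gT &-> X}).

Lemma min_fixing_uniq (th : 'CF([set: gT])) m m' :
  min_fixing to th m -> min_fixing to th m' -> m = m'.
Proof.
case=> [[A <- nzA] minA] [[B <- nzB] minB].
by apply/eqP; rewrite eqn_leq minA // minB.
Qed.

Lemma fixed_sum_set0 (j : Iirr [set: gT]) :
  (\sum_(x in 'C(set0 | to)) 'chi_j x != 0) = (j == 0).
Proof.
rewrite -sum_irr_eq0; congr (_ != 0); apply: eq_bigl => x.
by apply/astabP=> y; rewrite inE.
Qed.

Lemma min_fixing_eq0 (j : Iirr [set: gT]) : min_fixing to 'chi_j 0 -> j = 0.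
Proof.
by case=> [[A /eqP]]; rewrite cards_eq0 => /eqP->; rewrite fixed_sum_set0 => /eqP.
Qed.

Lemma min_fixing_triv : min_fixing to 'chi[[set: gT]]_0 0.
Proof. by split=> //; exists set0; rewrite ?cards0 ?fixed_sum_set0. Qed.

End MinFixing.

Lemma card_sigma_set (I : finType) (X : I -> finType) (A : {set {i & X i}}) :
  #|A| = (\sum_i #|[set x : X i | Tagged X x \in A]|)%N.
Proof.
rewrite -sum1_card; transitivity (\sum_i \sum_(x : X i | Tagged X x \in A) 1)%N.
  by rewrite sig_big_dep /=; apply: eq_bigl => -[i x].
by apply: eq_bigr => i _; rewrite -sum1_card; apply: eq_bigl => x; rewrite inE.
Qed.

Section ProductOfSylows.

Variables (p n : nat).
Local Notation E i := (expo_nth (p := p) (n := n) i).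
Local Notation PI := (Pprod p n).

Let coord i := dffun_morphism (fun i => Ppow p (E i)) i.

Let coord_inj : {in [set: PI] &, forall u v, (forall i, coord i u = coord i v) -> u = v}.
Proof. by move=> u v _ _ eq_uv; apply/ffunP. Qed.

Lemma irr_cf_prod (j : Iirr [set: PI]) :
  exists phi : {dffun forall i, Iirr [set: Ppow p (E i)]},
    'chi_j = cf_prod (fun i => 'chi_(phi i)).
Proof. by apply: (irr_cf_coord (f := coord) (mk := id)) => // k; rewrite inE. Qed.

Lemma prod_fixed_sum (A : {set points p n}) th :
  \sum_(u in 'C(A | prod_action p n)) cf_prod th u =
  \prod_i \sum_(x in 'C([set x : Xpow p (E i) | Tagged (fun i => Xpow p (E i)) x \in A] | actpow p (E i)))
    th i x.
Proof.
apply: (cf_coord_fixed_sum (f := coord) (mk := id)) => // [k|u _|].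
- by rewrite inE.
- apply/astabP/forallP => [fix_u i|fix_u [i x] Ax].
    apply/astabP=> x; rewrite inE => /fix_u/eqP; rewrite /= /prod_act /=.
    by rewrite eq_Tagged => /eqP.
  by rewrite /= /prod_act /=; congr Tagged; apply: (astabP (fix_u i)); rewrite inE.
exact: subsetT.
Qed.

Lemma min_fixing_prod (phi : forall i, Iirr [set: Ppow p (E i)]) (m : 'I_(size (expo p n)) -> nat) :
    (forall i, min_fixing (actpow p (E i)) 'chi_(phi i) (m i)) ->
  min_fixing (prod_action p n) (cf_prod (fun i => 'chi_(phi i))) (\sum_i m i).
Proof.
move=> min_m; split=> [|A].
  have exA i : exists A : {set Xpow p (E i)},
      (#|A| == m i) && (\sum_(x in 'C(A | actpow p (E i))) 'chi_(phi i) x != 0).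
    by have [[A cardA nzA] _] := min_m i; exists A; rewrite cardA eqxx.
  pose B i := xchoose (exA i).
  pose A : {set points p n} := [set u | tagged u \in B (tag u)].
  have defA i : [set x : Xpow p (E i) | Tagged (fun i => Xpow p (E i)) x \in A] = B i.
    by apply/setP=> x; rewrite !inE.
  exists A.
    rewrite card_sigma_set; apply: eq_bigr => i _; rewrite defA.
    by case/andP: (xchooseP (exA i)) => /eqP.
  rewrite prod_fixed_sum; apply/prodf_neq0 => i _; rewrite defA.
  by case/andP: (xchooseP (exA i)).
rewrite prod_fixed_sum => /prodf_neq0 nz; rewrite card_sigma_set.
by apply: leq_sum => i _; have [_] := min_m i; apply; exact: nz.
Qed.

End ProductOfSylows.

(** * Irreducible characters of wreath products *)

Section WreathCharacters.

Variables (p : nat) (gT : finGroupType).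
Hypothesis p_prime : prime p.
Local Notation W := (wreath p gT).
Local Notation N := (wreath_base p gT).
Local Notation K := [set: gT].
Local Notation coord := (@wreath_coord p gT).

Lemma mem_wreath_base (u : W) : (u \in N) = (u.2 == 0).
Proof. by apply/kerP/eqP => //; rewrite inE. Qed.

Lemma wreath_base_normal : N <| [set: W].
Proof. exact: ker_normal. Qed.

Let mk (k : {dffun forall i : 'Z_p, gT}) : W := (finfun (fun i => k i), 0).

Let mkN k : mk k \in N. Proof. by rewrite mem_wreath_base. Qed.

Let coord_mk k i : coord i (mk k) = k i. Proof. by rewrite /= ffunE. Qed.

Let coord_inj : {in N &, forall u v, (forall i, coord i u = coord i v) -> u = v}.
Proof.
move=> [f c] [g d]; rewrite !mem_wreath_base /= => /eqP-> /eqP-> eq_fg.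
by congr (_, _); apply/ffunP.
Qed.

Lemma cf_baseE (th : 'Z_p -> 'CF(K)) u : u \in N -> cf_base th u = \prod_i th i (u.1 i).
Proof. exact: (@cf_coordE _ _ _ _ coord). Qed.

Lemma cfdot_base (th th' : 'Z_p -> 'CF(K)) :
  '[cf_base th, cf_base th'] = \prod_i '[th i, th' i].
Proof. exact: (cfdot_coord mkN coord_mk coord_inj). Qed.

Lemma base_fixed_sum (Q : {set W}) (R : 'Z_p -> {set gT}) (th : 'Z_p -> 'CF(K)) :
    {in N, forall u, (u \in Q) = [forall i, u.1 i \in R i]} -> Q \subset N ->
  \sum_(u in Q) cf_base th u = \prod_i \sum_(x in R i) th i x.
Proof. exact: (cf_coord_fixed_sum mkN coord_mk coord_inj). Qed.

Lemma irr_cf_base (j : Iirr N) : exists phi : {ffun 'Z_p -> Iirr K},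
  'chi_j = cf_base (fun i => 'chi_(phi i)).
Proof.
have [phi ->] := irr_cf_coord mkN coord_mk coord_inj j.
by exists [ffun i => phi i]; apply: eq_bigr => i _; rewrite ffunE.
Qed.

Lemma cf_base_irr (phi : 'Z_p -> Iirr K) : cf_base (fun i => 'chi_(phi i)) \in irr N.
Proof. exact: (cf_coord_irr mkN coord_mk coord_inj). Qed.

Lemma cfRes_Ind_base (th : 'Z_p -> 'CF(K)) :
  'Res[N] ('Ind[[set: W]] (cf_base th)) = \sum_c cf_base (fun i => th (i + c)).
Proof.
apply/cfun_inP=> u Nu; rewrite cfResE ?normal_sub ?wreath_base_normal //.
rewrite cfIndE ?normal_sub ?wreath_base_normal // sum_cfunE.
under [RHS]eq_bigr => c _ do rewrite cf_baseE //.
have u2 : u.2 = 0 by apply/eqP; rewrite -mem_wreath_base.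
(* Conjugation inside the base group is absorbed by the class functions; only
   the shift by y.2 remains. *)
have conj_val (y : W) : cf_base th (u ^ y)%g = \prod_i th (i + y.2) (u.1 i).
  have Nuy : (u ^ y)%g \in N by rewrite memJ_norm // (subsetP (normal_norm wreath_base_normal) y (in_setT y)).
  rewrite cf_baseE // (reindex_inj (addIr y.2)) /=; apply: eq_bigr => i _.
  rewrite -[RHS](cfunJ _ _ (in_setT (y.1 i))); congr (th _ _).
  by rewrite conjgE /= !ffunE /= addrK u2 addr0 mulgA.
have cardN : #|N|%:R = #|{ffun 'Z_p -> gT}|%:R :> algC.
  rewrite (card_coord mkN coord_mk coord_inj) prodr_const card_ffun.
  by rewrite cardsT -natrX.
transitivity (#|N|%:R^-1 * \sum_(h : {ffun 'Z_p -> gT}) \sum_c \prod_i th (i + c) (u.1 i)).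
  congr (_ * _); rewrite pair_big /=; apply: eq_big => [y|y _]; rewrite ?inE //.
rewrite sumr_const cardN -[X in _ * X]mulr_natl mulKf //.
by rewrite -cardN pnatr_eq0 -lt0n cardG_gt0.
Qed.

(** For p prime, every nonzero shift generates the cyclic group. *)
Lemma Zp_shift_const (I : Type) (phi : 'Z_p -> I) c :
  c != 0 -> (forall i, phi (i + c) = phi i) -> forall i j, phi i = phi j.
Proof.
move=> c0 shift.
have shiftn i k : phi (i + c *+ k) = phi i.
  by elim: k => [|k IHk]; rewrite ?mulr0n ?addr0 // mulrSr addrA shift.
have Uc : c \is a GRing.unit.
  rewrite -[c]natr_Zp unitZpE ?prime_gt1 // prime_coprime //.
  rewrite gtnNdvd ?lt0n //; last by rewrite -[ltnRHS](Zp_cast (prime_gt1 p_prime)).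
suff all0 i : phi i = phi 0 by move=> i j; rewrite !all0.
rewrite -(shiftn 0 (i / c)) add0r -mulr_natl natr_Zp divrK //.
Qed.

(** The restriction to the base group is the sum of the p shifts of the product;
    for a mixed family only the trivial shift reproduces it, because every other
    one generates the cyclic group.  So the norm is 1 by Frobenius reciprocity. *)
Lemma cfInd_base_irr (phi : 'Z_p -> Iirr K) :
    ~~ [forall i, forall j, phi i == phi j] ->
  'Ind[[set: W]] (cf_base (fun i => 'chi_(phi i))) \in irr [set: W].
Proof.
move=> mixed; rewrite irrEchar cfInd_char ?irr_char ?irrWchar ?cf_base_irr //=.
rewrite -cfdot_Res_l cfRes_Ind_base cfdot_suml (bigD1 0) //= big1 => [|c c0].
  by rewrite addr0 cfdot_base big1 // => i _; rewrite addr0 cfnorm_irr.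
rewrite cfdot_base; apply/eqP/prodf_eq0.
have /existsP[i ne_i] : [exists i, phi (i + c) != phi i].
  apply: contraR mixed; rewrite negb_exists => /forallP shift.
  apply/forallP=> i; apply/forallP=> j; apply/eqP; apply: (Zp_shift_const c0) => k.
  by apply/eqP; rewrite -[_ == _]negbK.
by exists i => //; rewrite cfdot_irr (negPf ne_i).
Qed.

Lemma cfXE (j : Iirr K) (psi : 'CF([set: 'Z_p])) u : u \in N ->
  cfX j psi u = (\prod_i 'chi_j (u.1 i)) * psi 0.
Proof.
rewrite mem_wreath_base => /eqP u2; rewrite /cfX cfunE; congr (_ * _); last first.
  by rewrite /cfPull cfMorphE ?subxx ?inE // cfResE ?subsetT ?mem_morphim ?inE //= u2.
rewrite cfunE inE mulr1n /mxtrace.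
transitivity (\sum_(a : {ffun 'Z_p -> 'I_(irr_degree (socle_of_Iirr j))})
    \prod_i 'Chi_j (u.1 i) (a i) (a i)).
  rewrite [RHS](reindex _ (onW_bij _ (enum_val_bij _))) /=.
  by apply: eq_bigr => a _; rewrite mxE; apply: eq_bigr => i _; rewrite u2 addr0.
rewrite -(bigA_distr_bigA (fun i k => 'Chi_j (u.1 i) k k)).
by apply: eq_bigr => i _; rewrite -irrRepr cfunE inE mulr1n.
Qed.

Lemma irr_Zp_lin (eps : Iirr [set: 'Z_p]) : 'chi_eps \is a linear_char.
Proof. by apply: irr_prime_lin; rewrite cardsT card_Zp_p. Qed.

Lemma cfRes_cfX (j : Iirr K) (eps : Iirr [set: 'Z_p]) :
  'Res[N] (cfX j 'chi_eps) = cf_base (fun=> 'chi_j).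
Proof.
apply/cfun_inP=> u Nu; rewrite cfResE ?normal_sub ?wreath_base_normal //.
rewrite cfXE // cf_baseE //.
by rewrite lin_char1 ?mulr1 //; exact: irr_Zp_lin.
Qed.

Lemma cfX_char (j : Iirr K) (psi : 'CF([set: 'Z_p])) :
  psi \is a character -> cfX j psi \is a character.
Proof.
move=> Npsi; rewrite /cfX rpredM ?cfRepr_char //.
by rewrite /cfPull cfMorph_char ?cfRes_char.
Qed.

(** Already the restriction to the base group is irreducible. *)
Lemma cfX_irr (j : Iirr K) (eps : Iirr [set: 'Z_p]) :
  cfX j 'chi_eps \in irr [set: W].
Proof.
apply: (@cfRes_irr_irr _ _ N); first by rewrite cfX_char ?irr_char.
by rewrite cfRes_cfX cf_base_irr.
Qed.

(** Tensoring with the regular character of C_p kills everything outside the base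
    group, as induction from the base group does. *)
Lemma cfInd_base_const (j : Iirr K) :
  'Ind[[set: W]] (cf_base (fun=> 'chi_j)) = \sum_eps cfX j 'chi[[set: 'Z_p]]_eps.
Proof.
have cardZ : #|[set: 'Z_p]| = p by rewrite cardsT card_Zp_p.
have -> : \sum_eps cfX j 'chi[[set: 'Z_p]]_eps = cfX j (cfReg [set: 'Z_p]).
  rewrite /cfX -mulr_sumr cfReg_sum /cfPull !linear_sum; congr (_ * _).
  apply: eq_bigr => eps _; rewrite lin_char1 ?scale1r //.
  exact: irr_Zp_lin.
apply/cfunP=> u; have [Nu|N'u] := boolP (u \in N).
  rewrite -(cfResE _ (normal_sub wreath_base_normal) Nu) cfRes_Ind_base sum_cfunE.
  rewrite (eq_bigr (fun=> \prod_i 'chi_j (u.1 i))) => [|c _]; last by rewrite cf_baseE.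
  by rewrite cfXE // cfRegE eqxx mulr1n sumr_const cardZ card_Zp_p // mulr_natr.
rewrite (cfun_on0 (cfInd_normal _ wreath_base_normal)) // /cfX cfunE.
rewrite [X in _ * X](_ : _ = 0) ?mulr0 //.
rewrite /cfPull cfMorphE ?subxx ?inE // cfResE ?subsetT ?mem_morphim ?inE //=.
by rewrite cfRegE; rewrite mem_wreath_base in N'u; rewrite (negPf N'u).
Qed.

(** Clifford theory for the base group: an irreducible character lies in the
    induction of a product character, which is irreducible in the mixed case and
    splits into the extensions X(phi; eps) otherwise. *)
Lemma irr_wreath (k : Iirr [set: W]) :
  (exists j, exists eps : Iirr [set: 'Z_p], 'chi_k = cfX j 'chi_eps)
  \/ (exists2 phi : {ffun 'Z_p -> Iirr K}, ~~ [forall i, forall j, phi i == phi j]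
      & 'chi_k = 'Ind[[set: W]] (cf_base (fun i => 'chi_(phi i)))).
Proof.
have irr_eq xi : xi \in irr [set: W] -> '['chi_k, xi] != 0 -> 'chi_k = xi.
  case/irrP=> l ->; rewrite cfdot_irr pnatr_eq0 eqb0 negbK.
  by move/eqP->.
have [l] := constt_cfRes_irr N k; rewrite irr_consttE cfdot_Res_l.
have [phi ->] := irr_cf_base l => nz.
have [/forallP const|mixed] := boolP [forall i, forall j, phi i == phi j]; last first.
  by right; exists phi; rewrite // (irr_eq _ (cfInd_base_irr mixed)).
left; exists (phi 0).
have /existsP[eps eps_nz] : [exists eps : Iirr [set: 'Z_p], '['chi_k, cfX (phi 0) 'chi_eps] != 0].
  apply: contraR nz; rewrite negb_exists => /forallP z.
  have -> : cf_base (fun i => 'chi_(phi i)) = cf_base (fun=> 'chi_(phi 0)).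
    by apply: eq_bigr => i _; rewrite (eqP (forallP (const i) 0)).
  rewrite cfInd_base_const cfdot_sumr big1 // => eps _.
  by apply/eqP; rewrite -[_ == _]negbK; exact: z.
by exists eps; apply: irr_eq eps_nz; exact: cfX_irr.
Qed.

End WreathCharacters.

(** * Minimal fixing sets for wreath products *)

Section WreathFixedSums.

Variables (p : nat) (gT : finGroupType) (X : finType) (to : {action gT &-> X}).
Hypothesis p_prime : prime p.
Local Notation W := (wreath p gT).
Local Notation N := (wreath_base p gT).
Local Notation K := [set: gT].
Local Notation toW := (wreath_action p to).
Implicit Types (A : {set 'Z_p * X}).

Local Notation slice A i := [set x : X | (i, x) \in A].

Lemma card_slices A : #|A| = (\sum_i #|slice A i|)%N.
Proof.
rewrite -sum1_card; transitivity (\sum_i \sum_(x | (i, x) \in A) 1)%N.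
  by rewrite pair_big_dep /=; apply: eq_bigl => -[i x].
by apply: eq_bigr => i _; rewrite -sum1_card; apply: eq_bigl => x; rewrite inE.
Qed.

Lemma base_stab_sum A (th : 'Z_p -> 'CF(K)) :
  \sum_(u in 'C_N(A | toW)) cf_base th u = \prod_i \sum_(x in 'C(slice A i | to)) th i x.
Proof.
apply: base_fixed_sum; last exact: subsetIl.
move=> u Nu; rewrite in_setI Nu /=; rewrite mem_wreath_base in Nu.
apply/astabP/forallP => [fix_u i|fix_u [i x] Ax].
  by apply/astabP=> x; rewrite inE => /fix_u /(congr1 snd).
rewrite /= /wreath_act /= (eqP Nu) addr0; congr (_, _).
by apply: (astabP (fix_u i)); rewrite inE.
Qed.

(** An element outside the base group moves every copy of X to another one. *)
Lemma astab_sub_base A : A != set0 -> 'C(A | toW) \subset N.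
Proof.
case/set0Pn=> -[i x] Ax; apply/subsetP=> u /astabP/(_ _ Ax)/(congr1 fst)/= fix_i.
by rewrite mem_wreath_base -(inj_eq (addrI i)) fix_i addr0.
Qed.

(** Induced characters (S everything) and the characters X(phi; eps) (S trivial)
    both restrict to the base group as a sum of shifts of a product character.
    The lower bound only uses the part of the stabiliser inside the base group;
    the construction glues minimal sets of the factors, and the positivity of the
    total size ensures that nothing outside the base group fixes the result. *)
Lemma min_fixing_wreath (th : 'CF([set: W])) (phi : 'Z_p -> Iirr K)
    (S : {set 'Z_p}) (m : 'Z_p -> nat) :
    th \is a character -> 0 \in S ->
    'Res[N] th = \sum_(c in S) cf_base (fun i => 'chi_(phi (i + c))) ->
    (forall i, min_fixing to 'chi_(phi i) (m i)) -> (0 < \sum_i m i)%N ->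
  min_fixing toW th (\sum_i m i).
Proof.
move=> Nth S0 resE min_m m_gt0.
have sNW : N \subset [set: W] by exact: subsetT.
have sum_th A : \sum_(u in 'C_N(A | toW)) th u = \sum_(c in S)
    \prod_i \sum_(x in 'C(slice A i | to)) 'chi_(phi (i + c)) x.
  transitivity (\sum_(u in 'C_N(A | toW)) 'Res[N] th u).
    by apply: eq_bigr => u /setIP[Nu _]; rewrite cfResE.
  rewrite resE; under eq_bigr => u _ do rewrite sum_cfunE.
  by rewrite exchange_big; apply: eq_bigr => c _; rewrite base_stab_sum.
split=> [|A].
  have exA i : exists A : {set X},
      (#|A| == m i) && (\sum_(x in 'C(A | to)) 'chi_(phi i) x != 0).
    by have [[A cardA nzA] _] := min_m i; exists A; rewrite cardA eqxx.
  pose B i := xchoose (exA i).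
  pose A := [set u : 'Z_p * X | u.2 \in B u.1].
  have defA i : slice A i = B i by apply/setP=> x; rewrite !inE.
  have cardA : #|A| = (\sum_i m i)%N.
    rewrite card_slices; apply: eq_bigr => i _; rewrite defA.
    by case/andP: (xchooseP (exA i)) => /eqP.
  exists A => //.
  have A0 : A != set0 by rewrite -card_gt0 cardA.
  rewrite -(setIidPr (astab_sub_base A0)) sum_th (bigD1 0) //=.
  have fix0 : \prod_i \sum_(x in 'C(slice A i | to)) 'chi_(phi (i + 0)) x != 0.
    apply/prodf_neq0 => i _; rewrite addr0 defA.
    by case/andP: (xchooseP (exA i)).
  have ge0 c : 0 <= \prod_i \sum_(x in 'C(slice A i | to)) 'chi_(phi (i + c)) x.
    by apply: prodr_ge0 => i _; rewrite sum_group_char_ge0 ?subsetT ?irr_char.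
  by rewrite paddr_eq0 ?sumr_ge0 // (negPf fix0).
move=> nz.
have : \sum_(u in 'C_N(A | toW)) th u != 0.
  by apply: sum_group_char_sub nz; rewrite ?subsetIr ?subsetT.
rewrite sum_th => nzN.
have /exists_inP[c _ /prodf_neq0 nz_c] : [exists c in S,
    \prod_i \sum_(x in 'C(slice A i | to)) 'chi_(phi (i + c)) x != 0].
  apply: contraR nzN; rewrite negb_exists_in => /forall_inP z.
  by rewrite big1 // => c Sc; apply/eqP; rewrite -[_ == _]negbK; exact: z.
rewrite card_slices (reindex_inj (addIr c)) /=.
by apply: leq_sum => i _; have [_] := min_m (i + c); apply; exact: nz_c.
Qed.

Lemma min_fixing_Ind_base (phi : 'Z_p -> Iirr K) (m : 'Z_p -> nat) :
    ~~ [forall i, forall j, phi i == phi j] ->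
    (forall i, min_fixing to 'chi_(phi i) (m i)) ->
  min_fixing toW ('Ind[[set: W]] (cf_base (fun i => 'chi_(phi i)))) (\sum_i m i).
Proof.
move=> mixed min_m; apply: (@min_fixing_wreath _ phi setT) => //.
- by rewrite cfInd_char ?irrWchar ?cf_base_irr.
- by rewrite inE.
- by rewrite cfRes_Ind_base //; apply: eq_bigl => c; rewrite inE.
rewrite lt0n; apply: contra mixed; rewrite sum_nat_eq0 => /forallP m0.
have phi0 i : phi i = 0.
  by apply: (@min_fixing_eq0 _ _ to); rewrite -[X in min_fixing _ _ X](eqP (m0 i)).
by apply/forallP=> i; apply/forallP=> j; rewrite !phi0.
Qed.

Lemma min_fixing_cfX (j : Iirr K) (eps : Iirr [set: 'Z_p]) m :
    min_fixing to 'chi_j m -> (0 < m)%N ->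
  min_fixing toW (cfX j 'chi_eps) (p * m).
Proof.
move=> min_m m_gt0.
have -> : (p * m = \sum_(i : 'Z_p) m)%N by rewrite sum_nat_const card_Zp_p.
apply: (@min_fixing_wreath _ (fun=> j) [set 0]) => //.
- by rewrite cfX_char ?irr_char.
- by rewrite inE.
- by rewrite cfRes_cfX // big_set1.
by rewrite sum_nat_const card_Zp_p // muln_gt0 prime_gt0.
Qed.

Lemma cfX0E (psi : 'CF([set: 'Z_p])) u : cfX (0 : Iirr K) psi u = psi u.2.
Proof.
rewrite /cfX cfunE /cfPull cfMorphE ?subxx ?inE // cfResE ?subsetT ?mem_morphim ?inE //=.
rewrite -[RHS]mul1r; congr (_ * _); rewrite cfunE inE mulr1n.
have chi1 x : \tr ('Chi_(0 : Iirr K) x) = 1.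
  have : cfRepr 'Chi_(0 : Iirr K) x = 1 by rewrite irrRepr irr0 cfun1E inE.
  by rewrite cfunE inE mulr1n.
have d1 : irr_degree (socle_of_Iirr (0 : Iirr K)) = 1%N.
  apply/eqP; rewrite -eqC_nat -irr1_degree irr0 cfun1E inE //.
move: chi1; move: 'Chi_(0 : Iirr K); rewrite d1 => rK chi1.
have card1 : #|{ffun 'Z_p -> 'I_1}| = 1%N by rewrite card_ffun card_ord exp1n.
rewrite /mxtrace (eq_bigr (fun=> 1)) ?sumr_const ?card_ord ?card1 // => a _.
rewrite mxE big1 // => i _; rewrite [tensor_index a i]ord1 [tensor_index a _]ord1.
by rewrite -[RHS](chi1 (u.1 i)) /mxtrace big_ord1.
Qed.

(** For eps <> 0 the character is nontrivial but trivial on the base group, which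
    contains the stabiliser of any single point. *)
Lemma min_fixing_cfX0 (x0 : X) (eps : Iirr [set: 'Z_p]) :
  min_fixing toW (cfX (0 : Iirr K) 'chi_eps) (eps != 0).
Proof.
have /irrP[k def_k] := cfX_irr p_prime (0 : Iirr K) eps.
have k0 : (k == 0) = (eps == 0).
  apply/eqP/eqP=> [k0|eps0].
    apply/irr_inj/cfunP=> c; have := cfX0E 'chi_eps (([ffun=> 1%g], c) : W).
    by rewrite def_k k0 !irr0 !cfun1E !inE => <-.
  by apply/irr_inj/cfunP=> u; rewrite -def_k cfX0E eps0 !irr0 !cfun1E !inE.
have [eps0|eps_neq0] := eqVneq eps 0.
  by rewrite def_k (eqP (etrans k0 (introT eqP eps0))); exact: min_fixing_triv.
split=> [|A].
  exists [set (0, x0)]; rewrite ?cards1 //.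
  rewrite (eq_bigr (fun=> 1)); first by rewrite sumr_const pnatr_eq0 -lt0n cardG_gt0.
  move=> u Cu; have A0 : [set (0 : 'Z_p, x0)] != set0 by rewrite -card_gt0 cards1.
  have := subsetP (astab_sub_base A0) u Cu; rewrite mem_wreath_base cfX0E => /eqP->.
  by rewrite lin_char1 ?irr_Zp_lin.
apply: contraR; rewrite -leqNgt leqn0 cards_eq0 => /eqP->.
by rewrite -[_ == 0]negbK def_k fixed_sum_set0 k0.
Qed.

End WreathFixedSums.

(** * The recursion for gamma_0 *)

Section Trees.

Variable p : nat.

Definition has_person k (T : tree p k) : bool := [exists v : vertex p k, person T v].

Definition lowest_person k (T : tree p k) (x : seq 'Z_p) : bool :=
  person T x && ~~ [exists y : vertex p k, descendant T 1 x y].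

Lemma descendant_cons k (T : tree p k.+1) t i j x y :
  descendant T t (i :: x) (j :: y) = (i == j) && descendant (T.2 i) t x y.
Proof.
rewrite /descendant /=; have [->|] := eqVneq i j; last by rewrite !andbF.
rewrite -!andbA /= subSS -[(size x).+2]add1n iotaDl -map_comp !count_map.
by do 3!congr (_ && _).
Qed.

Lemma lowest_person_cons k (T : tree p k.+1) i x :
  lowest_person T (i :: x) = lowest_person (T.2 i) x.
Proof.
rewrite /lowest_person; congr (_ && ~~ _); apply/existsP/existsP=> -[y].
  case: y => -[|j y] le_y; first by rewrite /descendant /= !andbF.
  rewrite descendant_cons => /andP[_ desc].
  by exists (Bseq (le_y : size y <= k)%N).
by exists (Bseq (valP y : size (i :: y) <= k.+1)%N); rewrite descendant_cons eqxx.
Qed.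

(** A person at minimal depth below the root is a 1-descendant of the root, since
    no vertex strictly between them is a person. *)
Lemma root_descendant k (T : tree p k.+1) : person T [::] ->
  [exists y : vertex p k.+1, descendant T 1 [::] y] = [exists i, has_person (T.2 i)].
Proof.
move=> root_person; apply/existsP/existsP=> [[[[|i y] le_y]]|[i /existsP[v person_v]]].
- by rewrite /descendant /= !andbF.
- case/and4P=> _ person_y _ _; exists i; apply/existsP.
  by exists (Bseq (le_y : size y <= k)%N).
case: (@arg_minnP _ v (fun w : vertex p k => person (T.2 i) w) (fun w => size w) person_v) => w person_w min_w.
have count1 : count (person T) [seq take l (i :: w) | l <- iota 1 (size w + 1)] = 1%N.
  rewrite iotaD map_cat count_cat /= add0n take_size [person T (i :: w)]person_w.
  rewrite addn0 -[RHS]add0n; congr addn; apply/eqP.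
  rewrite -leqn0 leqNgt -has_count; apply/negP=> /hasP[u /mapP[[|l]]].
    by rewrite mem_iota.
  rewrite mem_iota add1n => /andP[_ lt_l] -> /= person_l; rewrite ltnS in lt_l.
  have le_l : (size (take l w) <= k)%N.
    by rewrite (leq_trans _ (valP w)) // size_take_min geq_minr.
  have /= := min_w (Bseq le_l) person_l.
  by rewrite size_take lt_l leqNgt lt_l.
exists (Bseq (valP w : size (i :: w) <= k.+1)%N).
rewrite /descendant root_person [person T _]person_w prefix0s.
have -> : (size (Bseq (valP w : size (i :: w) <= k.+1)%N) - size ([::] : seq 'Z_p) = size w + 1)%N.
  by rewrite subn0 addn1.
by rewrite count1.
Qed.

Lemma gamma0_treeE k (T : tree p k) :
  gamma0_tree T = (\sum_(v : vertex p k) lowest_person T v)%N.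
Proof.
rewrite /gamma0_tree -sum1_card big_mkcond; apply: eq_bigr => v _.
by rewrite inE -/(lowest_person T v); case: lowest_person.
Qed.

Lemma gamma0_tree0 (T : tree p 0) : gamma0_tree T = (0 < T < p)%N.
Proof.
have vertex0 (v : vertex p 0) : v = [bseq] by apply/val_inj; case: v => -[].
rewrite gamma0_treeE (bigD1 [bseq]) //= big1 ?addn0 => [|v /eqP[]]; last exact: vertex0.
rewrite /lowest_person [_ && ~~ _](_ : _ = person T [::]) //.
suff -> : [exists y : vertex p 0, descendant T 1 [::] y] = false by rewrite andbT.
by apply/existsP=> -[w]; rewrite (vertex0 w) /descendant /= !andbF.
Qed.

Lemma gamma0_treeS_person k (T : tree p k.+1) : gamma0_tree T =
  ((0 < T.1 < p)%N && ~~ [exists i, has_person (T.2 i)] + \sum_i gamma0_tree (T.2 i))%N.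
Proof.
pose h (u : unit + 'Z_p * vertex p k) : vertex p k.+1 :=
  match u with inl _ => [bseq] | inr iv => Bseq (valP iv.2 : size (iv.1 :: iv.2) <= k.+1)%N end.
have bij_h : bijective h.
  exists (fun v : vertex p k.+1 => match v with
    | Bseq [::] _ => inl tt
    | Bseq (i :: v) le_v => inr (i, Bseq (le_v : size v <= k)%N) end).
    by case=> [[]|[i [v le_v]]] //=; congr (inr (_, _)); exact: val_inj.
  by case=> -[|i v] le_v; exact: val_inj.
rewrite gamma0_treeE (reindex h) /=; last exact: onW_bij.
rewrite big_sumType /=; congr addn.
  rewrite (bigD1 tt) //= big1 ?addn0 => [|[]//].
  rewrite /lowest_person; case: (boolP (person T [::])) => [root_person|].
    by rewrite [(0 < _ < _)%N]root_person root_descendant.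
  by rewrite /person /= => /negPf->.
rewrite -(pair_bigA _ (fun i (v : vertex p k) => nat_of_bool (lowest_person T (i :: v)))) /=.
apply: eq_bigr => i _; rewrite gamma0_treeE; apply: eq_bigr => v _.
by rewrite lowest_person_cons.
Qed.

Lemma has_personS k (T : tree p k.+1) :
  has_person T = (0 < T.1 < p)%N || [exists i, has_person (T.2 i)].
Proof.
apply/existsP/orP => [[[[|i v] le_v] person_v]|]; first by left.
  by right; apply/existsP; exists i; apply/existsP; exists (Bseq (le_v : size v <= k)%N).
case=> [person_root|/existsP[i /existsP[v person_v]]]; first by exists [bseq].
by exists (Bseq (valP v : size (i :: v) <= k.+1)%N).
Qed.

Lemma gamma0_tree_gt0 k (T : tree p k) : (0 < gamma0_tree T)%N = has_person T.
Proof.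
elim: k T => [|k IHk] T.
  rewrite gamma0_tree0 lt0b; apply/idP/existsP => [personT|[v]]; first by exists [bseq].
  by case: v => -[].
have sum_gt0 : (0 < \sum_i gamma0_tree (T.2 i))%N = [exists i, has_person (T.2 i)].
  rewrite lt0n sum_nat_eq0 negb_forall; apply: eq_existsb => i.
  by rewrite /= -IHk lt0n.
rewrite gamma0_treeS_person has_personS -sum_gt0 addn_gt0 lt0b.
by case: (0 < T.1 < p)%N => //=; case: (0 < \sum_i _)%N.
Qed.

(** A subtree contains a person iff its [gamma0_tree] is positive (a deepest person
    is counted), so the recursion needs no other information on the subtrees. *)
Lemma gamma0_treeS k (T : tree p k.+1) (m := (\sum_i gamma0_tree (T.2 i))%N) :
  gamma0_tree T = (((0 < T.1 < p) && (m == 0)) + m)%N.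
Proof.
rewrite gamma0_treeS_person -/m; congr (nat_of_bool (_ && _) + _)%N.
rewrite -[m == 0]negbK -lt0n; congr (~~ _); rewrite lt0n sum_nat_eq0 negb_forall.
by apply: eq_existsb => i; rewrite implyTb -lt0n gamma0_tree_gt0.
Qed.

Lemma gamma0_tree_equiv k (T U : tree p k) : tree_equiv T U -> gamma0_tree T = gamma0_tree U.
Proof.
have step (V V' : tree p k) : rot_step V V' -> gamma0_tree V = gamma0_tree V'.
  elim: k V V' {T U} => [|k IHk] V V' //= /andP[/eqP eq_root rot].
  rewrite !gamma0_treeS eq_root.
  suff -> : (\sum_i gamma0_tree (V.2 i) = \sum_i gamma0_tree (V'.2 i))%N by [].
  case/orP: rot => [/existsP[c /forallP rot]|/existsP[i /andP[rot /forallP fix_i]]].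
    rewrite (reindex_inj (addIr c)) /=; apply: eq_bigr => i _.
    by rewrite (eqP (rot i)).
  rewrite (bigD1 i) //= [RHS](bigD1 i) //= (IHk _ _ rot); congr addn.
  by apply: eq_bigr => j ne_ij; have := fix_i j; rewrite ne_ij => /eqP->.
case/connectP=> s; elim: s T => [|V s IHs] T /=; first by move=> _ ->.
by case/andP=> /step-> path_s def_U; apply: IHs.
Qed.

End Trees.

(** * Sylow subgroups *)

Section Towers.

Variable p : nat.
Hypothesis p_prime : prime p.

Lemma Nirr_Zp : Nirr [set: 'Z_p] = p.
Proof.
rewrite -[LHS]card_ord card_Iirr_abelian ?cardsT ?card_Zp_p //.
by apply: cyclic_abelian; apply: prime_cyclic; rewrite cardsT card_Zp_p.
Qed.

Lemma irr_Zp_ltn (eps : Iirr [set: 'Z_p]) : (eps < p)%N.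
Proof. by rewrite -[X in (_ < X)%N]Nirr_Zp ltn_ord. Qed.

Lemma irr_Zp_person (eps : Iirr [set: 'Z_p]) : (0 < eps < p)%N = (eps != 0).
Proof. by rewrite irr_Zp_ltn andbT lt0n. Qed.

Lemma min_fixing_Zp (eps : Iirr [set: 'Z_p]) : min_fixing (acttow p 0) 'chi_eps (eps != 0).
Proof.
have [->|eps_neq0] := eqVneq eps 0; first exact: min_fixing_triv.
split=> [|A].
  exists [set (1%g : 'Z_p)]; rewrite ?cards1 //.
  rewrite (big_pred1 1%g) ?lin_char1 ?irr_Zp_lin ?oner_eq0 // => u.
  apply/astabP/eqP=> [/(_ 1%g (set11 _))|-> x _]; last exact: act1.
  by rewrite /= mul1g.
apply: contraR; rewrite -leqNgt leqn0 cards_eq0 => /eqP->.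
by rewrite -[_ == 0]negbK fixed_sum_set0.
Qed.

Lemma Xtow_point k : Xtow p k.
Proof. by elim: k => [|k x]; [exact: 0 | exact: (0, x)]. Qed.

(** Every tree in the class computes the intrinsic number, by uniqueness of the
    minimum, whichever of the descriptions of ['chi_j] the tree comes from. *)
Lemma Tclass_min_fixing k (j : Iirr [set: Ptow p k]) :
  Tclass 'chi_j != set0
  /\ forall T, T \in Tclass 'chi_j -> min_fixing (acttow p k) 'chi_j (gamma0_tree T).
Proof.
elim: k j => [|k IHk] j.
  split=> [|T]; last first.
    rewrite inE => /existsP[eps /andP[/eqP-> /eqP def_T]].
    by rewrite gamma0_tree0 def_T irr_Zp_person; exact: min_fixing_Zp.
  apply/set0Pn; exists (Ordinal (leqW (irr_Zp_ltn j)) : 'I_p.+1).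
  by rewrite inE; apply/existsP; exists j; rewrite eqxx /=.
split.
  apply/set0Pn.
  have exT (l : Iirr [set: Ptow p k]) : exists T, T \in Tclass 'chi_l.
    by apply/set0Pn; have [] := IHk l.
  have [[l [eps def_j]]|[phi mixed def_j]] := irr_wreath p_prime j.
    have [T0 T0l] := exT l.
    pose T : tree p k.+1 := (Ordinal (leqW (irr_Zp_ltn eps)), [ffun=> T0]).
    exists T; rewrite inE; apply/existsP; exists T; rewrite /tree_equiv connect0 /=.
    apply/orP; left; apply/existsP; exists l; apply/existsP; exists eps.
    by rewrite def_j !eqxx /=; apply/forallP=> i; rewrite ffunE.
  pose T : tree p k.+1 := (ord_max, [ffun i => xchoose (exT (phi i))]).
  exists T; rewrite inE; apply/existsP; exists T; rewrite /tree_equiv connect0 /=.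
  apply/orP; right; apply/existsP; exists phi; rewrite mixed def_j !eqxx /=.
  by apply/forallP=> i; rewrite ffunE; exact: (xchooseP (exT (phi i))).
move=> U; rewrite inE => /existsP[T /andP[/gamma0_tree_equiv <- /orP[]]].
  case/existsP=> l /existsP[eps /and3P[/eqP-> /eqP root_T /forallP child_T]].
  have min_l i : min_fixing (acttow p k) 'chi_l (gamma0_tree (T.2 i)).
    by have [_] := IHk l; apply; exact: child_T.
  have eq_child i : gamma0_tree (T.2 i) = gamma0_tree (T.2 0).
    exact: min_fixing_uniq (min_l i) (min_l 0).
  rewrite gamma0_treeS (eq_bigr (fun=> gamma0_tree (T.2 0))) => [|i _]; last exact: eq_child.
  rewrite sum_nat_const card_Zp_p // muln_eq0 (gtn_eqF (prime_gt0 p_prime)) /= root_T irr_Zp_person.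
  have min0 := min_l 0; have [g0|g_gt0] := posnP (gamma0_tree (T.2 0)); last first.
    by rewrite andbF add0n; apply: min_fixing_cfX.
  (* b(phi) = 0 means that phi is trivial, and a person at the root then counts. *)
  rewrite g0 muln0 addn0 andbT; rewrite g0 in min0.
  rewrite (min_fixing_eq0 min0); exact: min_fixing_cfX0 (Xtow_point k) _.
case/existsP=> phi /and4P[mixed /eqP-> /eqP root_T /forallP child_T].
rewrite gamma0_treeS root_T ltnn andbF add0n; apply: min_fixing_Ind_base => // i.
by have [_] := IHk (phi i); apply; exact: child_T.
Qed.

Lemma min_fixing_pow k (j : Iirr [set: Ppow p k]) :
  min_fixing (actpow p k) 'chi_j (gamma0_pow 'chi_j).
Proof.
case: k j => [|k] j /=.
  suff -> : j = 0 by exact: min_fixing_triv.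
  apply/eqP; rewrite -sum_irr_eq0 big_ord1.
  have -> : ord0 = 1%g :> 'I_1 by apply/val_inj.
  exact: irr1_neq0.
rewrite /gamma0_tow; case: pickP => [T|none]; first by have [_] := Tclass_min_fixing j; apply.
by have [/set0Pn[T]] := Tclass_min_fixing j; rewrite none.
Qed.

Lemma min_fixing_gamma0_prod n (j : Iirr [set: Pprod p n]) :
  min_fixing (prod_action p n) 'chi_j (gamma0_prod 'chi_j).
Proof.
rewrite /gamma0_prod; case: pickP => [phi /eqP->|none].
  by apply: min_fixing_prod => i; exact: min_fixing_pow.
by have [phi def_j] := irr_cf_prod j; have := none phi; rewrite def_j eqxx.
Qed.

Lemma fixed_sum_Psyl n (th : 'CF(Psyl p n)) (A : {set points p n}) :
  \sum_(s in 'C_(Psyl p n)(A | 'P)) th s = \sum_(u in 'C(A | prod_action p n)) cfMorph th u.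
Proof.
have injE : injective (Pembed p n).
  by move=> u v eq_uv; apply: (injmP (Pembed_inj p n)) eq_uv; rewrite inE.
have -> : 'C_(Psyl p n)(A | 'P) = Pembed p n @: 'C(A | prod_action p n).
  apply/setP=> s; apply/setIP/imsetP=> [[/morphimP[u _ _ ->] /astabP fix_s]|[u /astabP fix_u ->]].
    exists u => //; apply/astabP=> x Ax; have := fix_s x Ax.
    by rewrite /= apermE actpermE.
  split; first by rewrite mem_morphim ?inE.
  by apply/astabP=> x Ax; rewrite /= apermE actpermE; exact: fix_u.
rewrite big_imset /= => [|u v _ _]; last exact: injE.
by apply: eq_bigr => u _; rewrite cfMorphE ?inE.
Qed.

Lemma Psyl_even n : odd p -> {in Psyl p n, forall s : {perm _}, ~~ odd_perm s}.
Proof.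
move=> odd_p s Ps; have odd_P : odd #|Psyl p n| by rewrite card_Psyl // oddX odd_p orbT.
have odd_s : odd #[s] by apply: dvdn_odd odd_P; exact: order_dvdG.
have odd_pow k : odd_perm (s ^+ k)%g = odd k && odd_perm s.
  elim: k => [|k IHk]; first by rewrite expg0 odd_perm1.
  by rewrite expgS odd_permM IHk /=; case: (odd k); case: odd_perm.
by have := odd_pow #[s]; rewrite expg_order odd_perm1 odd_s /= => <-.
Qed.

End Towers.

Local Close Scope ring_scope.
Local Open Scope nat_scope.

Theorem theorem5p2 (p : nat) (p_prime : prime p) (p_ge5 : 5 <= p)
    (n : nat) (n_gt0 : 0 < n) (theta : 'CF(Psyl p n))
    (theta_irr : theta \in irr (Psyl p n)) :
  Mbound theta = n - gamma0 theta.
Proof.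
have odd_p : odd p by case: (even_prime p_prime) p_ge5 => [->|].
have cardX := card_points p_prime n.
have [j def_theta] := irrP theta_irr.
have [k def_k] : exists k : Iirr [set: Pprod p n], cfMorph theta = ('chi_k)%R.
  by apply/irrP; rewrite cfMorph_irr // subxx.
have [[A cardA nzA] minA] := min_fixing_gamma0_prod p_prime k.
rewrite /gamma0 def_k; set g := gamma0_prod _ in cardA minA *.
have le_m (la : partition_of n) m : la \in Omega theta ->
    m = head 0%N (parts la) \/ m = size (parts la) -> (m <= n - g)%N.
  rewrite inE def_theta => nz def_m.
  have [B cardB nzB] := specht_fixed_sum cardX (@Psyl_even p p_prime n odd_p) nz def_m.
  rewrite -(addKn #|B| m) cardB leq_sub2l // minA // -def_k -fixed_sum_Psyl //.
  by rewrite def_theta.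
have [la la_nz la_head] : exists2 la : partition_of n, la \in Omega theta
    & (n - g <= head 0 (parts la))%N.
  have [|la nz le_la] := @fixed_sum_specht _ n cardX (Psyl p n) j A.
    by rewrite -def_theta fixed_sum_Psyl // def_k.
  by exists la; rewrite ?inE ?def_theta // -cardA.
have head_gt0 : (0 < head 0 (parts la))%N.
  have [_ la_gt0 sum_la] := parts_spec la.
  by move: la_gt0 sum_la n_gt0; case: (parts la) => [|m s] /= => [_ <-|/andP[]].
rewrite /Mbound; case: ex_minnP => t /andP[t_gt0 Omega_t] min_t.
apply/eqP; rewrite eqn_leq; apply/andP; split.
  apply: min_t; apply/andP; split.
    by apply: leq_trans head_gt0 (le_m la _ la_nz _); left.
  apply/subsetP=> mu Omu; rewrite inE.
  by apply/andP; split; apply: (le_m mu) => //; [left | right].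
apply: leq_trans la_head _.
by have := subsetP Omega_t _ la_nz; rewrite inE => /andP[].
Qed.
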